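(* The following assertion is false: for every $f\in L_2(\mathbb{R}^2)$ the map $t\mapsto A_t f$ is in $L_2(\mathbb{R},L_\infty(\mathbb{R}^2))$, and there exists a constant $c$ independent of $f$ such that $$\left(\int_{-\infty}^\infty \|A_t f\|_{\infty}^2\,dt\right)^{1/2}\le c\,\|f\|_2 \quad\text{for all } f\in L_2(\mathbb{R}^2).$$
   Context: For $f\in L_2(\mathbb{R}^2)$ and $t\in\mathbb{R}$, $A_t f=u(t,\cdot)$, where $u$ is the solution of the Schrödinger equation with zero potential $\partial_t u(t,x)=-i\Delta u(t,x)$, $u(0,x)=f(x)$, with $t\in\mathbb{R}$, $x\in\mathbb{R}^2$. Equivalently, in terms of the Fourier transform in the space variable, $\hat h(\zeta)=\int_{\mathbb{R}^2} e^{-ix\cdot\zeta}h(x)\,dx$ (extended to $L_2$), one has $\widehat{A_t f}(\zeta)=\exp(it|\zeta|^2)\hat f(\zeta)$. Here $\|\cdot\|_2$ and $\|\cdot\|_\infty$ are the norms of $L_2(\mathbb{R}^2)$ and $L_\infty(\mathbb{R}^2)$. Saying that $t\mapsto A_tf$ is in $L_2(\mathbb{R},L_\infty(\mathbb{R}^2))$ means that $A_t f\in L_\infty(\mathbb{R}^2)$ for almost every $t$ and $\int_{-\infty}^\infty\|A_tf\|_\infty^2\,dt<\infty$. *)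

(* Defs.v *)
From HB Require Import structures.
From mathcomp Require Import all_boot all_order all_algebra.
From mathcomp Require Import complex.
From mathcomp Require Import all_classical all_reals all_analysis.

Set Implicit Arguments.
Unset Strict Implicit.
Unset Printing Implicit Defensive.
Import Order.TTheory GRing.Theory Num.Theory.
Import numFieldNormedType.Exports.

Local Open Scope classical_set_scope.
Local Open Scope ring_scope.
Local Open Scope complex_scope.

Definition leb2 (R : realType) : {measure set (measurableTypeR R * measurableTypeR R) -> \bar R} :=
  (@lebesgue_measure R \x @lebesgue_measure R)%E.

(* The norm of R[i] is R[i]-valued; [normc] is the R-valued modulus. *)
Definition modulus (R : realType) (z : R[i]) : R := Normc.normc z.

Definition LpnormC (R : realType) (p : \bar R) (f : R * R -> R[i]) : \bar R :=
  Lnorm (@leb2 R) p (fun x => (modulus (f x))%:E).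

(* Elements of L_p(R^2) are represented by (Borel) measurable functions, which
   are never quotiented by a.e. equality; for p = +oo, [LpnormC] is the
   essential supremum of the modulus. *)
Definition in_Lp (R : realType) (p : \bar R) (f : R * R -> R[i]) : Prop :=
  [/\ measurable_fun [set: measurableTypeR R * measurableTypeR R]
        (fun x => complex.Re (f x)),
      measurable_fun [set: measurableTypeR R * measurableTypeR R]
        (fun x => complex.Im (f x)) &
      (LpnormC p f < +oo)%E].

Definition expi (R : realType) (theta : R) : R[i] := cos theta +i* sin theta.

Definition dot2 (R : realType) (x y : R * R) : R := x.1 * y.1 + x.2 * y.2.

Definition cintegral2 (R : realType) (f : R * R -> R[i]) : R[i] :=
  Rintegral (@leb2 R) [set: R * R] (fun x => complex.Re (f x)) +i*
  Rintegral (@leb2 R) [set: R * R] (fun x => complex.Im (f x)).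

(* Meaningful for integrable h; the transform on L_2 is [is_fourier_L2]. *)
Definition fourier (R : realType) (h : R * R -> R[i]) (zeta : R * R) : R[i] :=
  cintegral2 (fun x => expi (- dot2 x zeta) * h x).

(* F represents the Fourier transform of f in L_2: the graph of the continuous
   extension to L_2 is the closure in L_2 * L_2 of the graph of [fourier] on
   the intersection of L_1 and L_2. *)
Definition is_fourier_L2 (R : realType) (f F : R * R -> R[i]) : Prop :=
  [/\ in_Lp 2%:E f, in_Lp 2%:E F &
    exists h : nat -> R * R -> R[i],
      [/\ forall n, in_Lp 1%:E (h n) /\ in_Lp 2%:E (h n),
          LpnormC 2%:E (fun x => h n x - f x) @[n --> \oo] --> 0%E &
          LpnormC 2%:E (fun z => fourier (h n) z - F z) @[n --> \oo] --> 0%E]].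

(* g represents the solution at time t of du/dt = - i Delta u, u(0) = f, whose
   Fourier transform is exp (i t |zeta|^2) times that of f. *)
Definition is_schrodinger (R : realType) (t : R) (f g : R * R -> R[i]) : Prop :=
  exists F : R * R -> R[i],
    is_fourier_L2 f F /\
    is_fourier_L2 g (fun zeta => expi (t * dot2 zeta zeta) * F zeta).

(* By Plancherel's theorem the representative exists for every f in L_2 and is
   unique up to a.e. equality; the value 0 is only used outside L_2. *)
Definition schrodinger (R : realType) (t : R) (f : R * R -> R[i]) :
    R * R -> R[i] :=
  xget (fun=> 0) [set g | is_schrodinger t f g].

Definition sq_time_integral (R : realType) (u : R -> R * R -> R[i]) : \bar R :=
  (\int[@lebesgue_measure R]_t (LpnormC +oo (u t) ^+ 2))%E.

Definition in_L2_Linfty (R : realType) (u : R -> R * R -> R[i]) : Prop :=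
  {ae @lebesgue_measure R, forall t, in_Lp +oo%E (u t)} /\
  (sq_time_integral u < +oo)%E.

(* Main.v *)
Require Import Defs.
From HB Require Import structures.
From mathcomp Require Import all_boot all_order all_algebra.
From mathcomp Require Import complex ring lra zify.
From mathcomp Require Import all_classical all_reals all_analysis.
From mathcomp Require Import measurable_realfun ess_sup_inf.

(**
Let f be the sum over j < N of the Gaussian packets that refocus at time j and
position (b_j, 0).  During the time interval [l, l+1] the norm ||A_t f||_oo
controls the pairing T_l of f with the l-th packet, while ||f||_2^2 is the sum
of the T_l; by Cauchy-Schwarz, the inequality would give ||f||_2^2 = O(N).  On
the other hand ||f||_2^2 is the sum of the entries of an explicit Gram matrix G,
and Re G(j,k) >= kappa |b_j - b_k|^2 / |j - k|^2 for j <> k provided that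
|b_j - b_k|^2 <= |j - k|.  For b the self-similar 1/2-Hoelder walk with
b(4q + r) = 2 b(q) +- h(r), each scale 4^m contributes a fixed multiple of N, so
that ||f||_2^2 is at least of order N log N.

Plancherel's theorem is avoided: the solution is tested against Gaussians only,
through the duality int F k = int f k^, and all norms are explicit Gaussian
integrals.
*)

Set Implicit Arguments.
Unset Strict Implicit.
Unset Printing Implicit Defensive.
Import Order.TTheory GRing.Theory Num.Theory.
Import numFieldNormedType.Exports.

Local Open Scope classical_set_scope.
Local Open Scope ring_scope.
Local Open Scope complex_scope.

(** * Complex-valued integration *)

Section complex_algebra.
Context {R : realType}.
Implicit Types z w : R[i].

(** With all b_j = 0 the real part of G(j,k) would be 2 pi / (4 + (j - k)^2), which is summable and
    only gives ||f||_2^2 = O(N). The modulus of G(j,k) is of order 1 / |j - k|, but this size sits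
    in the imaginary part: for s = j - k and y = b_j - b_k, the entry is close to (pi / (i s)) exp
    (i y^2 / (4 s)). A displacement with y^2 comparable to |s| turns the phase by a fixed amount, so
    that the real part too is of order 1 / |s|, and the harmonic sum produces log N. A much larger
    displacement could make the real part negative; hence the constraint y^2 <= |s|, and hence a
    path whose increments have order exactly |s|^(1/2) on every scale. Brownian paths have
    increments of this size but no uniform 1/2-Hoelder bound. *)

Lemma complex_eqP z w :
  complex.Re z = complex.Re w -> complex.Im z = complex.Im w -> z = w.
Proof. by case: z w => [a b] [c d] /= -> ->. Qed.

Lemma cReD z w : complex.Re (z + w) = complex.Re z + complex.Re w.
Proof. by case: z w => [a b] [c d]. Qed.

Lemma cImD z w : complex.Im (z + w) = complex.Im z + complex.Im w.
Proof. by case: z w => [a b] [c d]. Qed.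

Lemma cReN z : complex.Re (- z) = - complex.Re z.
Proof. by case: z. Qed.

Lemma cImN z : complex.Im (- z) = - complex.Im z.
Proof. by case: z. Qed.

Lemma cReM z w : complex.Re (z * w) =
  complex.Re z * complex.Re w - complex.Im z * complex.Im w.
Proof. by case: z w => [a b] [c d]. Qed.

Lemma cImM z w : complex.Im (z * w) =
  complex.Re z * complex.Im w + complex.Im z * complex.Re w.
Proof. by case: z w => [a b] [c d]. Qed.

Lemma Re_sum I (r : seq I) (F : I -> R[i]) :
  complex.Re (\sum_(i <- r) F i) = \sum_(i <- r) complex.Re (F i).
Proof. by elim/big_ind2: _ => // x1 x2 y1 y2 <- <-; rewrite cReD. Qed.

Definition ReImE := (cReD, cImD, cReN, cImN, cReM, cImM).

Lemma modulusE z : modulus z = Num.sqrt (complex.Re z ^+ 2 + complex.Im z ^+ 2).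
Proof. by case: z. Qed.

Lemma modulus_ge0 z : 0 <= modulus z.
Proof. by rewrite modulusE sqrtr_ge0. Qed.

Lemma modulusM z w : modulus (z * w) = modulus z * modulus w.
Proof. exact: Normc.normcM. Qed.

Lemma modulusV z : modulus z^-1 = (modulus z)^-1.
Proof. exact: Normc.normcV. Qed.

Lemma modulusD z w : modulus (z + w) <= modulus z + modulus w.
Proof. exact: le_normcD. Qed.

Lemma modulusN z : modulus (- z) = modulus z.
Proof. exact: normcN. Qed.

Lemma modulus0 : modulus (0 : R[i]) = 0.
Proof. by rewrite modulusE /= expr0n addr0 sqrtr0. Qed.

Lemma modulus1 : modulus (1 : R[i]) = 1.
Proof. by rewrite modulusE /= expr0n addr0 expr1n sqrtr1. Qed.

Lemma modulus_real (r : R) : modulus r%:C = `|r|.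
Proof. by rewrite modulusE /= expr0n addr0 sqrtr_sqr. Qed.

Lemma sqr_modulus z : modulus z ^+ 2 = complex.Re z ^+ 2 + complex.Im z ^+ 2.
Proof. by rewrite modulusE sqr_sqrtr// addr_ge0 ?sqr_ge0. Qed.

Lemma modulus_conj z : modulus z^*%C = modulus z.
Proof. by rewrite !modulusE; case: z => a b /=; rewrite sqrrN. Qed.

Lemma mulcJ z : z * z^*%C = (modulus z ^+ 2)%:C.
Proof.
by rewrite sqr_modulus; case: z => a b; apply: complex_eqP => /=; ring.
Qed.

Lemma Re_le_modulus z : `|complex.Re z| <= modulus z.
Proof. by rewrite modulusE -sqrtr_sqr ler_wsqrtr// lerDl sqr_ge0. Qed.

Lemma Im_le_modulus z : `|complex.Im z| <= modulus z.
Proof. by rewrite modulusE -sqrtr_sqr ler_wsqrtr// lerDr sqr_ge0. Qed.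

Lemma modulus_le_ReIm z : modulus z <= `|complex.Re z| + `|complex.Im z|.
Proof.
rewrite -(@ler_pXn2r _ 2) ?nnegrE ?modulus_ge0 ?addr_ge0//.
rewrite sqr_modulus sqrrD !real_normK ?num_real// lerD2r lerDl.
by rewrite mulrn_wge0// mulr_ge0.
Qed.

Definition cexp z : R[i] := (expR (complex.Re z))%:C * expi (complex.Im z).

Lemma Re_cexp z : complex.Re (cexp z) = expR (complex.Re z) * cos (complex.Im z).
Proof. by rewrite /cexp cReM /= mul0r subr0. Qed.

Lemma Im_cexp z : complex.Im (cexp z) = expR (complex.Re z) * sin (complex.Im z).
Proof. by rewrite /cexp cImM /= mul0r addr0. Qed.

Lemma modulus_cexp z : modulus (cexp z) = expR (complex.Re z).
Proof.
rewrite modulusM modulus_real ger0_norm ?expR_ge0// modulusE /=.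
by rewrite cos2Dsin2 sqrtr1 mulr1.
Qed.

Lemma cexpD z w : cexp (z + w) = cexp z * cexp w.
Proof.
apply: complex_eqP; rewrite !(ReImE, Re_cexp, Im_cexp) expRD ?cosD ?sinD; ring.
Qed.

Lemma cexp0 : cexp 0 = 1.
Proof.
by apply: complex_eqP; rewrite ?Re_cexp ?Im_cexp /= expR0 ?cos0 ?sin0 ?mulr1 ?mulr0.
Qed.

Lemma cexp_conj z : (cexp z)^*%C = cexp z^*%C.
Proof.
apply: complex_eqP; case: z => a b; rewrite ?Re_cexp ?Im_cexp /=; last first.
  by rewrite sinN; ring.
by rewrite cosN; ring.
Qed.

Lemma expiE (t : R) : expi t = cexp (0 +i* t).
Proof. by apply: complex_eqP; rewrite ?Re_cexp ?Im_cexp /= expR0 mul1r. Qed.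

Lemma cexp_real (r : R) : cexp r%:C = (expR r)%:C.
Proof.
by apply: complex_eqP; rewrite ?Re_cexp ?Im_cexp /= ?cos0 ?sin0 ?mulr1 ?mulr0.
Qed.

End complex_algebra.

Section complex_integral.
Context d (T : measurableType d) (R : realType).
Variable mu : {measure set T -> \bar R}.
Implicit Types (f g : T -> R[i]) (c : R[i]).

Definition cmeasurable f : Prop :=
  measurable_fun setT (fun x => complex.Re (f x)) /\
  measurable_fun setT (fun x => complex.Im (f x)).

Definition cintegrable f : Prop :=
  mu.-integrable setT (fun x => (complex.Re (f x))%:E) /\
  mu.-integrable setT (fun x => (complex.Im (f x))%:E).

Definition cint f : R[i] :=
  (\int[mu]_x complex.Re (f x)) +i* (\int[mu]_x complex.Im (f x)).

Lemma cmeasurable_cst c : cmeasurable (fun=> c).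
Proof. by split; exact: measurable_cst. Qed.

Lemma cmeasurableD f g : cmeasurable f -> cmeasurable g ->
  cmeasurable (fun x => f x + g x).
Proof.
move=> [f1 f2] [g1 g2]; split; under eq_fun do rewrite ?cReD ?cImD.
  exact: measurable_funD.
exact: measurable_funD.
Qed.

Lemma cmeasurableN f : cmeasurable f -> cmeasurable (fun x => - f x).
Proof.
move=> [f1 f2]; split; under eq_fun do rewrite ?cReN ?cImN.
  exact: measurableT_comp.
exact: measurableT_comp.
Qed.

Lemma cmeasurableM f g : cmeasurable f -> cmeasurable g ->
  cmeasurable (fun x => f x * g x).
Proof.
move=> [f1 f2] [g1 g2]; split; under eq_fun do rewrite ?cReM ?cImM.
  by apply: measurable_funB; exact: measurable_funM.
by apply: measurable_funD; exact: measurable_funM.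
Qed.

Lemma cmeasurable_conj f : cmeasurable f -> cmeasurable (fun x => (f x)^*%C).
Proof.
move=> [f1 f2]; split.
  by apply: eq_measurable_fun f1 => x _; case: (f x).
have : measurable_fun setT (fun x => - complex.Im (f x)).
  exact: measurableT_comp.
by apply: eq_measurable_fun => x _; case: (f x).
Qed.

Lemma cmeasurable_sum I (r : seq I) (F : I -> T -> R[i]) :
  (forall i, cmeasurable (F i)) -> cmeasurable (fun x => \sum_(i <- r) F i x).
Proof.
move=> mF; elim: r => [|i r IH].
  by under eq_fun do rewrite big_nil; exact: cmeasurable_cst.
by under eq_fun do rewrite big_cons; exact: cmeasurableD.
Qed.

Lemma measurable_modulus f : cmeasurable f ->
  measurable_fun setT (fun x => modulus (f x)).
Proof.
move=> [f1 f2]; under eq_fun do rewrite modulusE.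
apply: measurableT_comp; first by apply: continuous_measurable_fun; exact: sqrt_continuous.
by apply: measurable_funD; exact: measurable_funX.
Qed.

Lemma cmeasurable_cexp f : cmeasurable f -> cmeasurable (fun x => cexp (f x)).
Proof.
move=> [f1 f2]; split; under eq_fun do rewrite ?Re_cexp ?Im_cexp.
  apply: measurable_funM; first exact: measurableT_comp.
  by apply: measurableT_comp => //; apply: continuous_measurable_fun; exact: continuous_cos.
apply: measurable_funM; first exact: measurableT_comp.
by apply: measurableT_comp => //; apply: continuous_measurable_fun; exact: continuous_sin.
Qed.

Lemma cintegrable_measurable f : cintegrable f -> cmeasurable f.
Proof.
by move=> [/measurable_int/measurable_EFinP f1 /measurable_int/measurable_EFinP f2].
Qed.

Lemma le_cintegrable f (g : T -> R) : cmeasurable f ->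
  mu.-integrable setT (fun x => (g x)%:E) -> (forall x, modulus (f x) <= g x) ->
  cintegrable f.
Proof.
move=> [f1 f2] ig fg; split; apply: le_integrable ig => //;
  try exact/measurable_EFinP;
  move=> x _ /=; rewrite lee_fin (le_trans _ (ler_norm _))//;
  apply: le_trans (fg x).
  exact: Re_le_modulus.
exact: Im_le_modulus.
Qed.

Lemma integrable_modulus f : cintegrable f ->
  mu.-integrable setT (fun x => (modulus (f x))%:E).
Proof.
move=> /[dup] /cintegrable_measurable mf [f1 f2].
have i1 := integrable_norm f1; have i2 := integrable_norm f2.
apply: (le_integrable _ _ _ (integrableD _ i1 i2)) => //.
  exact/measurable_EFinP/measurable_modulus.
move=> x _ /=; rewrite lee_fin ger0_norm ?modulus_ge0// (le_trans _ (ler_norm _))//.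
exact: modulus_le_ReIm.
Qed.

Lemma cintegrableP f : cintegrable f <->
  cmeasurable f /\ mu.-integrable setT (fun x => (modulus (f x))%:E).
Proof.
split=> [f1|[mf f1]]; last by apply: (le_cintegrable mf f1) => x.
by split; [exact: cintegrable_measurable|exact: integrable_modulus].
Qed.

Lemma cintegrableD f g : cintegrable f -> cintegrable g ->
  cintegrable (fun x => f x + g x).
Proof.
move=> [f1 f2] [g1 g2]; split.
  by under eq_fun do rewrite cReD EFinD; exact: integrableD.
by under eq_fun do rewrite cImD EFinD; exact: integrableD.
Qed.

Lemma cintD f g : cintegrable f -> cintegrable g ->
  cint (fun x => f x + g x) = cint f + cint g.
Proof.
move=> [f1 f2] [g1 g2]; apply: complex_eqP; rewrite ?cReD ?cImD /=.
  by under eq_Rintegral do rewrite cReD; exact: RintegralD.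
by under eq_Rintegral do rewrite cImD; exact: RintegralD.
Qed.

Lemma cintegrable_cstM c f : cintegrable f -> cintegrable (fun x => c * f x).
Proof.
move=> [f1 f2]; split.
  under eq_fun do rewrite cReM EFinB !EFinM.
  by apply: integrableB => //; exact: integrableZl.
under eq_fun do rewrite cImM EFinD !EFinM.
by apply: integrableD => //; exact: integrableZl.
Qed.

Lemma cint_cstM c f : cintegrable f -> cint (fun x => c * f x) = c * cint f.
Proof.
have iZ (k : R) (h : T -> R) : mu.-integrable setT (fun x => (h x)%:E) ->
    mu.-integrable setT (EFin \o (fun x => k * h x)).
  by move=> ih; rewrite /comp; under eq_fun do rewrite EFinM; exact: integrableZl.
move=> [f1 f2]; apply: complex_eqP; rewrite ?cReM ?cImM /=.
  under eq_Rintegral do rewrite cReM.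
  rewrite RintegralB//; [|exact: iZ|exact: iZ].
  by rewrite !RintegralZl.
under eq_Rintegral do rewrite cImM.
rewrite RintegralD//; [|exact: iZ|exact: iZ].
by rewrite !RintegralZl.
Qed.

Lemma cintegrable0 : cintegrable (fun=> 0).
Proof. by split => /=; exact: integrable0. Qed.

Lemma cint0 : cint (fun=> 0) = 0.
Proof. by apply: complex_eqP => /=; rewrite /Rintegral integral0. Qed.

Lemma cintegrable_sum I (r : seq I) (F : I -> T -> R[i]) :
  (forall i, cintegrable (F i)) -> cintegrable (fun x => \sum_(i <- r) F i x).
Proof.
move=> mF; elim: r => [|i r IH].
  by under eq_fun do rewrite big_nil; exact: cintegrable0.
by under eq_fun do rewrite big_cons; exact: cintegrableD.
Qed.

Lemma cint_sum I (r : seq I) (F : I -> T -> R[i]) :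
  (forall i, cintegrable (F i)) ->
  cint (fun x => \sum_(i <- r) F i x) = \sum_(i <- r) cint (F i).
Proof.
move=> mF; elim: r => [|i r IH].
  by under [in LHS]eq_fun do rewrite big_nil; rewrite big_nil cint0.
under [in LHS]eq_fun do rewrite big_cons.
by rewrite cintD ?IH ?big_cons//; exact: cintegrable_sum.
Qed.

Lemma eq_cint f g : f =1 g -> cint f = cint g.
Proof. by move=> /funext ->. Qed.

(* |c| = Re (u c) for a unimodular u, and Re (u f) <= |f| pointwise. *)
Lemma modulus_cint f : cintegrable f ->
  modulus (cint f) <= \int[mu]_x modulus (f x).
Proof.
move=> intf; have [->|nz] := eqVneq (cint f) 0.
  by rewrite modulus0; apply: Rintegral_ge0 => x _; exact: modulus_ge0.
pose u := (cint f)^*%C / (modulus (cint f))%:C.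
have m0 : modulus (cint f) != 0.
  by apply: contra nz => /eqP /Normc.eq0_normc ->.
have mu1 : modulus u = 1.
  by rewrite modulusM modulus_conj modulusV modulus_real ger0_norm ?modulus_ge0// divff.
have -> : modulus (cint f) = complex.Re (cint (fun x => u * f x)).
  have mC : (modulus (cint f))%:C != 0 by apply: contra m0 => /eqP[/eqP].
  have -> : cint (fun x => u * f x) = (modulus (cint f))%:C; last by [].
  apply: (mulIf mC); rewrite cint_cstM// /u mulrAC mulfVK// mulrC mulcJ.
  by rewrite expr2 rmorphM.
have iuf := cintegrable_cstM u intf.
apply: le_Rintegral => //; first by case: iuf.
  exact: integrable_modulus.
move=> x _; rewrite (le_trans (ler_norm _))// (le_trans (Re_le_modulus _))//.
by rewrite modulusM mu1 mul1r.
Qed.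

End complex_integral.

(** * Fubini's theorem for complex-valued functions *)

Section complex_fubini.
Context d1 d2 (T1 : measurableType d1) (T2 : measurableType d2) (R : realType).
Variable m1 : {sigma_finite_measure set T1 -> \bar R}.
Variable m2 : {sigma_finite_measure set T2 -> \bar R}.

Lemma le_abse_fine (y : \bar R) : (`|(fine y)%:E| <= `|y|)%E.
Proof. by case: y => [r| |] /=; rewrite ?leey. Qed.

(** The real-valued inner integral is 0 where the extended one is infinite. Almost every slice is
    integrable, so this changes neither the integrability nor the value of the outer integral. *)
Lemma Rintegral_fubini1 (f : T1 * T2 -> R) :
  (m1 \x m2)%E.-integrable setT (EFin \o f) ->
  m1.-integrable setT (EFin \o (fun x => \int[m2]_y f (x, y))) /\
  \int[(m1 \x m2)%E]_z f z = \int[m1]_x (\int[m2]_y f (x, y)).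
Proof.
move=> fi; have iF := integrable_fubini_F fi.
have mF : measurable_fun setT (EFin \o (fun x => \int[m2]_y f (x, y))).
  apply/measurable_EFinP.
  apply: (measurableT_comp (@fine_measurable R setT measurableT)).
  exact: (measurable_int _ iF).
split.
  by apply: le_integrable iF => // x _; exact: le_abse_fine.
rewrite /Rintegral -integral12_prod_meas1//; congr fine.
apply: ae_eq_integral => //; first exact: (measurable_int _ iF).
have := ae_integrable1 fi; apply: filterS => x ix _.
by rewrite fineK// integrable_fin_num.
Qed.

Lemma Rintegral_fubini2 (f : T1 * T2 -> R) :
  (m1 \x m2)%E.-integrable setT (EFin \o f) ->
  m2.-integrable setT (EFin \o (fun y => \int[m1]_x f (x, y))) /\
  \int[(m1 \x m2)%E]_z f z = \int[m2]_y (\int[m1]_x f (x, y)).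
Proof.
move=> fi; have mf : measurable_fun setT (EFin \o f) by case/integrableP: fi.
have mG := measurable_fubini_G fi.
have iF : m2.-integrable setT (fubini_G m1 (EFin \o f)).
  apply/integrableP; split => //.
  apply: le_lt_trans ((integrable21ltyP m1 m2 mf).1 fi).
  apply: ge0_le_integral => //.
  - exact: measurableT_comp.
  - apply: (measurable_fun_fubini_tonelli_G (abse \o (EFin \o f))) => //=.
    exact: measurableT_comp.
  move=> y _; apply: le_abse_integral => //.
  exact: (@measurable_fun_pair1 _ _ _ _ _ _ (EFin \o f)).
have mF : measurable_fun setT (EFin \o (fun y => \int[m1]_x f (x, y))).
  apply/measurable_EFinP.
  apply: (measurableT_comp (@fine_measurable R setT measurableT)).
  exact: (measurable_int _ iF).
split.
  by apply: le_integrable iF => // x _; exact: le_abse_fine.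
rewrite /Rintegral -integral21_prod_meas1//; congr fine.
apply: ae_eq_integral => //.
have := ae_integrable2 fi; apply: filterS => x ix _.
by rewrite fineK// integrable_fin_num.
Qed.

Lemma cint_fubini1 (f : T1 * T2 -> R[i]) : cintegrable (m1 \x m2)%E f ->
  cintegrable m1 (fun x => cint m2 (fun y => f (x, y))) /\
  cint (m1 \x m2)%E f = cint m1 (fun x => cint m2 (fun y => f (x, y))).
Proof.
move=> [/Rintegral_fubini1[i1 e1] /Rintegral_fubini1[i2 e2]].
by split=> //; rewrite /cint e1 e2.
Qed.

Lemma cint_fubini2 (f : T1 * T2 -> R[i]) : cintegrable (m1 \x m2)%E f ->
  cintegrable m2 (fun y => cint m1 (fun x => f (x, y))) /\
  cint (m1 \x m2)%E f = cint m2 (fun y => cint m1 (fun x => f (x, y))).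
Proof.
move=> [/Rintegral_fubini2[i1 e1] /Rintegral_fubini2[i2 e2]].
by split=> //; rewrite /cint e1 e2.
Qed.

Lemma cmeasurable_fst (f : T1 -> R[i]) : cmeasurable f ->
  cmeasurable (fun z : T1 * T2 => f z.1).
Proof.
by move=> [f1 f2]; split; [apply: (measurableT_comp f1)|apply: (measurableT_comp f2)].
Qed.

Lemma cmeasurable_snd (f : T2 -> R[i]) : cmeasurable f ->
  cmeasurable (fun z : T1 * T2 => f z.2).
Proof.
by move=> [f1 f2]; split; [apply: (measurableT_comp f1)|apply: (measurableT_comp f2)].
Qed.

Lemma integrable_prod (f : T1 -> R) (g : T2 -> R) :
  m1.-integrable setT (EFin \o f) -> m2.-integrable setT (EFin \o g) ->
  (m1 \x m2)%E.-integrable setT (fun z => (f z.1 * g z.2)%:E).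
Proof.
move=> /integrableP[/measurable_EFinP mf lf] /integrableP[/measurable_EFinP mg lg].
have mfg : measurable_fun setT (fun z : T1 * T2 => (f z.1 * g z.2)%:E).
  apply/measurable_EFinP/measurable_funM.
    by apply: (measurableT_comp mf).
  by apply: (measurableT_comp mg).
apply/(integrable12ltyP m1 m2 mfg) => /=.
under eq_integral => x _.
  under eq_integral => y _ do rewrite /= normrM EFinM.
  rewrite ge0_integralZl//=; last first.
    by do 2 apply: measurableT_comp => //.
  over.
rewrite ge0_integralZr//=; last 2 first.
- by do 2 apply: measurableT_comp => //.
- by apply: integral_ge0.
have f0 : (0 <= \int[m1]_x `|(f x)%:E|)%E by apply: integral_ge0.
by apply: lte_mul_pinfty => //; rewrite ge0_fin_numE.
Qed.

Lemma cintegrable_prod (f : T1 -> R[i]) (g : T2 -> R[i]) :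
  cintegrable m1 f -> cintegrable m2 g ->
  cintegrable (m1 \x m2)%E (fun z => f z.1 * g z.2).
Proof.
move=> /cintegrableP[mf fi] /cintegrableP[mg gi]; apply/cintegrableP; split.
  by apply: cmeasurableM; [exact: cmeasurable_fst|exact: cmeasurable_snd].
under eq_fun do rewrite modulusM.
exact: (@integrable_prod (fun x => modulus (f x)) (fun y => modulus (g y))).
Qed.

Lemma cint_prod (f : T1 -> R[i]) (g : T2 -> R[i]) :
  cintegrable m1 f -> cintegrable m2 g ->
  cint (m1 \x m2)%E (fun z => f z.1 * g z.2) = cint m1 f * cint m2 g.
Proof.
move=> fi gi; have [_ ->] := cint_fubini1 (cintegrable_prod fi gi).
rewrite mulrC -cint_cstM//; apply: eq_cint => x /=.
by rewrite cint_cstM// mulrC.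
Qed.

End complex_fubini.

(** * Complex Gaussian integrals *)

Section complex_derivative.
Context {R : realType}.
Implicit Types (f g : R -> R[i]) (x : R).

Definition cderive f x (c : R[i]) : Prop :=
  is_derive x (1 : R) (fun y => complex.Re (f y)) (complex.Re c) /\
  is_derive x (1 : R) (fun y => complex.Im (f y)) (complex.Im c).

Lemma cderive_eq f x c c' : cderive f x c -> c = c' -> cderive f x c'.
Proof. by move=> + <-. Qed.

Lemma cderive_cst (k : R[i]) x : cderive (fun=> k) x 0.
Proof. by split; exact: is_derive_cst. Qed.

Lemma cderive_id x : cderive (fun y => y%:C) x 1.
Proof. by split; [exact: is_derive_id|exact: is_derive_cst]. Qed.

Lemma cderiveD f g x c e : cderive f x c -> cderive g x e ->
  cderive (fun y => f y + g y) x (c + e).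
Proof.
move=> [f1 f2] [g1 g2]; split.
  by under eq_fun do rewrite cReD; rewrite cReD; exact: is_deriveD.
by under eq_fun do rewrite cImD; rewrite cImD; exact: is_deriveD.
Qed.

Lemma cderiveM f g x c e : cderive f x c -> cderive g x e ->
  cderive (fun y => f y * g y) x (c * g x + f x * e).
Proof.
move=> [f1 f2] [g1 g2]; split.
  under eq_fun do rewrite cReM.
  by apply: is_derive_eq; rewrite cReD !cReM /GRing.scale/=; ring.
under eq_fun do rewrite cImM.
by apply: is_derive_eq; rewrite cImD !cImM /GRing.scale/=; ring.
Qed.

Lemma cderive_cstM k f x c : cderive f x c -> cderive (fun y => k * f y) x (k * c).
Proof.
move=> df; apply: (cderive_eq (cderiveM (cderive_cst k x) df)).
by rewrite mul0r add0r.
Qed.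

Lemma cderive_cexp f x c : cderive f x c ->
  cderive (fun y => cexp (f y)) x (c * cexp (f x)).
Proof.
move=> [f1 f2]; split.
  under eq_fun do rewrite Re_cexp.
  have := is_derive1_comp (is_derive_expR _) f1.
  have := is_derive1_comp (is_derive_cos _) f2.
  move=> h1 h2; apply: is_derive_eq.
  by rewrite cReM Re_cexp Im_cexp /GRing.scale /=; ring.
under eq_fun do rewrite Im_cexp.
have := is_derive1_comp (is_derive_expR _) f1.
have := is_derive1_comp (is_derive_sin _) f2.
move=> h1 h2; apply: is_derive_eq.
by rewrite cImM Re_cexp Im_cexp /GRing.scale /=; ring.
Qed.

Lemma cderive0_cst f x y : (forall z, cderive f z 0) -> f x = f y.
Proof.
move=> f0; apply: complex_eqP.
  by apply: (is_derive_0_is_cst (f := fun y => complex.Re (f y))) => z; case: (f0 z).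
by apply: (is_derive_0_is_cst (f := fun y => complex.Im (f y))) => z; case: (f0 z).
Qed.

End complex_derivative.

Section integral_of_derivative.
Context {R : realType}.
Notation mu := (@lebesgue_measure R).

(** The fundamental theorem on growing symmetric intervals, followed by dominated convergence; the
    bound on |x| |F x| forces F to 0 at both ends. It plays the part of integration by parts for the
    Gaussian moments. *)
Lemma integral_derive_eq0 (F f : R -> R) (K : R) :
  (forall x, is_derive x (1 : R) F (f x)) -> continuous f ->
  mu.-integrable setT (EFin \o f) -> (forall x, `|x| * `|F x| <= K) ->
  \int[mu]_x f x = 0.
Proof.
move=> dF cf fi FK.
(* Radius n + 1 keeps the interval nondegenerate at n = 0 and bounds the boundary terms by K / (n +
   1). *)
pose I (n : nat) : set R := `[- n.+1%:R, n.+1%:R]%classic.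
have E1 n : (\int[mu]_x (((EFin \o f) \_ (I n)) x) =
    (F n.+1%:R - F (- n.+1%:R))%R%:E)%E.
  rewrite -integral_mkcond (continuous_FTC2 (F := F)) ?EFinB//.
  - by rewrite (@lt_trans _ _ 0)// ?oppr_lt0 ltr0n.
  - exact: continuous_subspaceT.
  - have cF : continuous F by move=> x; apply/differentiable_continuous/derivable1_diffP.
    split; [by []|exact/cvg_at_right_filter/cF|exact/cvg_at_left_filter/cF].
  - by move=> x _; rewrite derive1E derive_val.
have L1 : (fun n => \int[mu]_x (((EFin \o f) \_ (I n)) x))%E @ \oo -->
    (\int[mu]_x (f x)%:E)%E.
  have mf := measurable_int _ fi.
  have m1 (n : nat) : measurable_fun setT ((EFin \o f) \_ (I n)).
    have mI : measurable (I n) by exact: measurable_itv.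
    exact: (proj1 (measurable_restrictT _ mI) (measurable_funTS mf)).
  have c1 : {ae mu, forall x, setT x ->
      ((EFin \o f) \_ (I n)) x @[n --> \oo] --> (EFin \o f) x}.
    apply: nearW => x _; apply: cvg_near_cst.
    near=> n; rewrite patchE mem_set//=.
    rewrite /I /= in_itv/= -ler_norml.
    rewrite (@le_trans _ _ n%:R)// ?ler_nat//.
    by near: n; exact: nbhs_infty_ger.
  have b1 : {ae mu, forall x, forall n : nat, setT x ->
      (`|((EFin \o f) \_ (I n)) x| <= (abse \o (EFin \o f)) x)%E}.
    apply: nearW => x n _; rewrite patchE; case: ifPn => _; first exact: lexx.
    by rewrite /= normr0 lee_fin.
  have := @dominated_convergence _ _ R mu setT measurableT _ _ _
    m1 mf c1 (integrable_abse fi) b1.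
  by case=> _ _; apply.
have L2 : (fun n => (F n.+1%:R - F (- n.+1%:R))%:E) @ \oo --> 0%E.
  apply: cvg_EFin; first exact: nearW.
  have K0 (s : nat -> R) : (forall n, `|s n| = n.+1%:R) -> (fun n => F (s n)) @ \oo --> 0.
    move=> sn.
    apply: norm_cvg0.
    apply: (@squeeze_cvgr _ _ _ _ (cst 0) (fun n => K * n.+1%:R^-1)).
    - near=> n; rewrite normr_ge0/= ler_pdivlMr ?ltr0n// mulrC.
      by rewrite -{1}(sn n).
    - exact: cvg_cst.
    - rewrite -[X in _ --> X](mulr0 K); apply: cvgM; first exact: cvg_cst.
      exact: cvg_harmonic.
  rewrite -[X in _ --> X](subr0 0); apply: cvgB; apply: K0 => n.
    by rewrite ger0_norm.
  by rewrite normrN ger0_norm.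
rewrite /Rintegral.
suff -> : (\int[mu]_x (f x)%:E = 0)%E by [].
move: L1; under eq_fun do rewrite E1.
by move/(cvg_unique _); apply.
Unshelve. all: end_near. Qed.

End integral_of_derivative.

Section gaussian1.
Context {R : realType}.
Notation mu := (@lebesgue_measure R).

Lemma cint_derive_eq0 (F f : R -> R[i]) (K : R) :
  (forall x, cderive F x (f x)) -> (forall x, exists c, cderive f x c) ->
  cintegrable mu f -> (forall x, `|x| * modulus (F x) <= K) ->
  cint mu f = 0.
Proof.
move=> dF cf [f1 f2] FK; apply: complex_eqP => /=.
  apply: (integral_derive_eq0 (F := fun x => complex.Re (F x)) (K := K)) => //.
  - by move=> x; have [] := dF x.
  - move=> x; have [c [dc _]] := cf x.
    exact/differentiable_continuous/derivable1_diffP.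
  - move=> x; apply: le_trans (FK x).
    by rewrite ler_wpM2l// Re_le_modulus.
apply: (integral_derive_eq0 (F := fun x => complex.Im (F x)) (K := K)) => //.
- by move=> x; have [] := dF x.
- move=> x; have [c [_ dc]] := cf x.
  exact/differentiable_continuous/derivable1_diffP.
- move=> x; apply: le_trans (FK x).
  by rewrite ler_wpM2l// Im_le_modulus.
Qed.

Lemma cderive_under_integral (E dE : R -> R -> R[i]) (a u v : R) (G : R -> R) :
  u < a < v ->
  (forall l, cintegrable mu (E l)) ->
  (forall l x, cderive (E ^~ x) l (dE l x)) ->
  (forall x, 0 <= G x) ->
  mu.-integrable setT (EFin \o G) ->
  (forall l x, u < l < v -> modulus (dE l x) <= G x) ->
  cderive (fun l => cint mu (E l)) a (cint mu (dE a)).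
Proof.
move=> auv iE ddE G0 iG dEG.
have Ia : `]u, v[%classic a by rewrite /= in_itv.
split=> /=.
- have d1 x y : `]u, v[%classic x -> setT y ->
      derivable ((fun l z => complex.Re (E l z)) ^~ y) x 1.
    by move=> _ _; have [[]] := ddE x y.
  have b1 x y : `]u, v[%classic x -> setT y ->
      `|partial1of2 (fun l z => complex.Re (E l z)) x y| <= G y.
    rewrite /= in_itv/= => uxv _; have [/@derive_val h _] := ddE x y.
    rewrite partial1of2E h; apply: le_trans (dEG _ _ uxv).
    exact: Re_le_modulus.
  have i1 x : `]u, v[%classic x -> mu.-integrable setT (EFin \o (fun z => complex.Re (E x z))).
    by move=> _; case: (iE x).
  apply: DeriveDef.
    exact: (derivable_under_integral measurableT Ia i1 d1 G0 iG b1).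
  rewrite -derive1E (differentiation_under_integral measurableT Ia i1 d1 G0 iG b1).
  apply: eq_Rintegral => x _; have [/@derive_val h _] := ddE a x.
  by rewrite /partial1of2 derive1E h.
- have d1 x y : `]u, v[%classic x -> setT y ->
      derivable ((fun l z => complex.Im (E l z)) ^~ y) x 1.
    by move=> _ _; have [_ []] := ddE x y.
  have b1 x y : `]u, v[%classic x -> setT y ->
      `|partial1of2 (fun l z => complex.Im (E l z)) x y| <= G y.
    rewrite /= in_itv/= => uxv _; have [_ /@derive_val h] := ddE x y.
    rewrite partial1of2E h; apply: le_trans (dEG _ _ uxv).
    exact: Im_le_modulus.
  have i1 x : `]u, v[%classic x -> mu.-integrable setT (EFin \o (fun z => complex.Im (E x z))).
    by move=> _; case: (iE x).
  apply: DeriveDef.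
    exact: (derivable_under_integral measurableT Ia i1 d1 G0 iG b1).
  rewrite -derive1E (differentiation_under_integral measurableT Ia i1 d1 G0 iG b1).
  apply: eq_Rintegral => x _; have [_ /@derive_val h] := ddE a x.
  by rewrite /partial1of2 derive1E h.
Qed.

(** Read off from the total mass of the centred normal density of variance 1 / (2 a). *)
Lemma gaussian_integral (a : R) : 0 < a ->
  mu.-integrable setT (EFin \o (fun x => expR (- (a * x ^+ 2)))) /\
  \int[mu]_x expR (- (a * x ^+ 2)) = Num.sqrt (pi / a).
Proof.
move=> a0; pose s := Num.sqrt (2 * a)^-1.
have s2 : s ^+ 2 = (2 * a)^-1 by rewrite sqr_sqrtr// invr_ge0 mulr_ge0// ltW.
have s0 : s != 0 by rewrite sqrtr_eq0 -ltNge invr_gt0 mulr_gt0.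
have E x : expR (- (a * x ^+ 2)) = (normal_peak s)^-1 * normal_pdf 0 s x.
  rewrite (normal_pdfE _ s0) /= mulrA mulVf ?mul1r ?gt_eqF ?normal_peak_gt0//.
  rewrite /normal_fun subr0 s2; congr expR.
  rewrite mulNr; congr (- _); rewrite mulrC; congr (_ * _).
  by rewrite -mulr_natl; field; rewrite gt_eqF.
have iN := integrable_normal_pdf 0 s.
split.
  rewrite /comp; under eq_fun do rewrite E EFinM.
  exact: integrableZl.
under eq_Rintegral do rewrite E.
rewrite RintegralZl// /Rintegral integral_normal_pdf mulr1.
rewrite /normal_peak invrK s2; congr Num.sqrt.
by field; rewrite gt_eqF.
Qed.

(** A common dominating function for a Gaussian times a factor of at most quadratic growth; this
    covers the moments of order 0, 1, 2 and the derivatives in the parameters. *)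
Definition gauss_bound (a b x : R) : R :=
  (1 + x ^+ 2) * expR (- (a * x ^+ 2) + b * `|x|).

Lemma gauss_bound_ge0 a b x : 0 <= gauss_bound a b x.
Proof. by rewrite mulr_ge0 ?expR_ge0// addr_ge0// sqr_ge0. Qed.

(** Half of the decay a x^2 is spent: one quarter absorbs 1 + x^2 through 1 + u <= exp u, another
    absorbs b |x| by completing the square. *)
Lemma gauss_bound_le (a b x : R) : 0 < a ->
  gauss_bound a b x <=
  (1 + 4 / a) * expR (b ^+ 2 / a) * expR (- (a / 2 * x ^+ 2)).
Proof.
move=> a0; have x20 : 0 <= x ^+ 2 by exact: sqr_ge0.
have h1 : 1 + x ^+ 2 <= (1 + 4 / a) * expR (a / 4 * x ^+ 2).
  apply: (@le_trans _ _ ((1 + 4 / a) * (1 + a / 4 * x ^+ 2))).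
    have -> : (1 + 4 / a) * (1 + a / 4 * x ^+ 2) =
        1 + x ^+ 2 + (a / 4 * x ^+ 2 + 4 / a).
      by field; rewrite gt_eqF.
    have a1 := ltW a0.
    by rewrite lerDl; apply: addr_ge0; [apply: mulr_ge0 => //|]; exact: divr_ge0.
  by rewrite ler_wpM2l ?expR_ge1Dx// addr_ge0// divr_ge0// ltW.
have h2 : b * `|x| <= b ^+ 2 / a + a / 4 * x ^+ 2.
  rewrite -subr_ge0 -(@real_normK _ x) ?num_real//.
  have -> : b ^+ 2 / a + a / 4 * `|x| ^+ 2 - b * `|x| =
      a * (b / a - `|x| / 2) ^+ 2 by field; rewrite gt_eqF.
  by rewrite mulr_ge0 ?sqr_ge0// ltW.
apply: (le_trans (ler_wpM2r (expR_ge0 _) h1)).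
rewrite -[leLHS]mulrA -[leRHS]mulrA ler_wpM2l ?addr_ge0 ?divr_ge0 ?(ltW a0)//.
rewrite -!expRD ler_expR.
have -> : b ^+ 2 / a + - (a / 2 * x ^+ 2) =
  a / 4 * x ^+ 2 - a * x ^+ 2 + (b ^+ 2 / a + a / 4 * x ^+ 2).
  by field; rewrite gt_eqF.
by rewrite -addrA lerD2l lerD2l.
Qed.

Lemma gauss_bound_ub (a b x : R) : 0 < a ->
  gauss_bound a b x <= (1 + 4 / a) * expR (b ^+ 2 / a).
Proof.
move=> a0; apply: (le_trans (gauss_bound_le b x a0)).
rewrite ler_piMr ?mulr_ge0 ?expR_ge0 ?addr_ge0 ?divr_ge0 ?(ltW a0)//.
by rewrite -expR0 ler_expR oppr_le0 mulr_ge0 ?sqr_ge0// divr_ge0// ltW.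
Qed.

Lemma measurable_gauss_bound a b : measurable_fun setT (gauss_bound a b).
Proof.
apply: measurable_funM.
  by apply: measurable_funD => //; exact: measurable_funX.
apply: measurableT_comp => //; apply: measurable_funD.
  by apply: measurableT_comp => //; apply: measurable_funM => //; exact: measurable_funX.
by apply: measurable_funM => //; exact: measurableT_comp.
Qed.

Lemma integrable_gauss_bound a b : 0 < a ->
  mu.-integrable setT (EFin \o gauss_bound a b).
Proof.
move=> a0.
have [i1 _] := gaussian_integral (divr_gt0 a0 (ltr0n R 2)).
have i2 := integrableZl measurableT ((1 + 4 / a) * expR (b ^+ 2 / a)) i1.
apply: le_integrable i2 => //.
  by apply/measurable_EFinP; exact: measurable_gauss_bound.
move=> x _ /=; rewrite lee_fin ger0_norm ?gauss_bound_ge0//.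
by rewrite (le_trans (gauss_bound_le _ _ a0))// ler_norm.
Qed.

Definition cgauss (w v : R[i]) (x : R) : R[i] :=
  cexp (- (w * (x ^+ 2)%:C) + v * x%:C).

Lemma modulus_cgauss_le w v x :
  modulus (cgauss w v x) <=
  expR (- (complex.Re w * x ^+ 2) + modulus v * `|x|).
Proof.
rewrite modulus_cexp ler_expR !ReImE /= !mulr0 !subr0 lerD2l.
rewrite (le_trans (ler_norm _))// normrM ler_wpM2r//.
exact: Re_le_modulus.
Qed.

Lemma cmeasurable_real (f : R -> R) : measurable_fun setT f ->
  cmeasurable (fun x => (f x)%:C).
Proof. by move=> mf; split => //=; exact: measurable_cst. Qed.

Lemma cmeasurable_cgauss w v : cmeasurable (cgauss w v).
Proof.
apply: cmeasurable_cexp; apply: cmeasurableD.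
  apply: cmeasurableN; apply: cmeasurableM; first exact: cmeasurable_cst.
  by apply: cmeasurable_real; exact: measurable_funX.
apply: cmeasurableM; first exact: cmeasurable_cst.
exact: cmeasurable_real.
Qed.

Lemma modulus_cgaussM_le w v (p : R[i]) x K : 0 <= K ->
  modulus p <= K * (1 + x ^+ 2) ->
  modulus (p * cgauss w v x) <= K * gauss_bound (complex.Re w) (modulus v) x.
Proof.
move=> K0 pK; rewrite modulusM /gauss_bound mulrA.
by rewrite ler_pM ?modulus_ge0 ?modulus_cgauss_le.
Qed.

Lemma cintegrable_cgaussM w v (p : R -> R[i]) K : 0 <= K -> 0 < complex.Re w ->
  cmeasurable p -> (forall x, modulus (p x) <= K * (1 + x ^+ 2)) ->
  cintegrable mu (fun x => p x * cgauss w v x).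
Proof.
move=> K0 w0 mp pK.
apply: (@le_cintegrable _ _ R mu _
  (fun x => K * gauss_bound (complex.Re w) (modulus v) x)).
- by apply: cmeasurableM => //; exact: cmeasurable_cgauss.
- under eq_fun do rewrite EFinM.
  by apply: integrableZl => //; exact: integrable_gauss_bound.
- by move=> x; exact: modulus_cgaussM_le.
Qed.

Lemma cintegrable_cgauss w v : 0 < complex.Re w -> cintegrable mu (cgauss w v).
Proof.
move=> w0; have := @cintegrable_cgaussM w v (fun=> 1) 1 ler01 w0 (cmeasurable_cst _ _).
under eq_fun do rewrite mul1r; apply => x.
by rewrite modulus1 mul1r lerDl sqr_ge0.
Qed.

Lemma modulus_le_1Dsqr (x : R) : modulus x%:C <= 1 * (1 + x ^+ 2).
Proof.
rewrite modulus_real mul1r -(@real_normK _ x) ?num_real//.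
by have : 0 <= (`|x| - 2^-1) ^+ 2 := sqr_ge0 _; nra.
Qed.

Lemma cintegrable_cgauss1 w v : 0 < complex.Re w ->
  cintegrable mu (fun x => x%:C * cgauss w v x).
Proof.
move=> w0; apply: (cintegrable_cgaussM _ ler01 w0) => [|x].
  exact: cmeasurable_real.
exact: modulus_le_1Dsqr.
Qed.

Lemma cintegrable_cgauss2 w v : 0 < complex.Re w ->
  cintegrable mu (fun x => (x ^+ 2)%:C * cgauss w v x).
Proof.
move=> w0; apply: (cintegrable_cgaussM _ ler01 w0) => [|x].
  by apply: cmeasurable_real; exact: measurable_funX.
by rewrite modulus_real mul1r ger0_norm ?sqr_ge0// lerDr.
Qed.

Lemma cderive_cgauss w v x :
  cderive (cgauss w v) x ((- (2 * w * x%:C) + v) * cgauss w v x).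
Proof.
apply: cderive_eq.
  apply: cderive_cexp; apply: cderiveD; last first.
    by apply: cderive_cstM; exact: cderive_id.
  rewrite (_ : (fun y => _) = (fun y => (- w) * (y%:C * y%:C))); last first.
    by apply/funext => y; rewrite expr2 rmorphM mulNr.
  by apply: cderive_cstM; apply: cderiveM; exact: cderive_id.
by rewrite /cgauss; ring.
Qed.

Lemma cgauss_bounded w v x (p : R[i]) : 0 < complex.Re w ->
  modulus p <= 1 * (1 + x ^+ 2) ->
  modulus (p * cgauss w v x) <=
  (1 + 4 / complex.Re w) * expR (modulus v ^+ 2 / complex.Re w).
Proof.
move=> w0 p1; apply: (le_trans (modulus_cgaussM_le w v ler01 p1)).
by rewrite mul1r gauss_bound_ub.
Qed.

(** The derivative of the Gaussian is (v - 2 w x) times the Gaussian and has integral 0.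
    [cgauss_moment2] applies the same argument to x times the Gaussian. *)
Lemma cgauss_moment1 w v : 0 < complex.Re w ->
  2 * w * cint mu (fun x => x%:C * cgauss w v x) = v * cint mu (cgauss w v).
Proof.
move=> w0; have i0 := cintegrable_cgauss v w0; have i1 := cintegrable_cgauss1 v w0.
pose f x := - (2 * w) * (x%:C * cgauss w v x) + v * cgauss w v x.
have ia : cintegrable mu (fun x => - (2 * w) * (x%:C * cgauss w v x)).
  exact: cintegrable_cstM.
have ib : cintegrable mu (fun x => v * cgauss w v x) by exact: cintegrable_cstM.
have : cint mu f = 0.
  apply: (@cint_derive_eq0 (cgauss w v) f
    ((1 + 4 / complex.Re w) * expR (modulus v ^+ 2 / complex.Re w))).
  - by move=> x; apply: cderive_eq (cderive_cgauss w v x) _; rewrite /f; ring.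
  - move=> x; eexists; apply: cderiveD; apply: cderive_cstM; last first.
      exact: cderive_cgauss.
    by apply: cderiveM; [exact: cderive_id|exact: cderive_cgauss].
  - exact: cintegrableD.
  - move=> x; rewrite -modulus_real -modulusM.
    by apply: cgauss_bounded => //; exact: modulus_le_1Dsqr.
rewrite cintD// !cint_cstM// => h.
by apply/eqP; rewrite -subr_eq0 -oppr_eq0 opprB addrC -mulNr h.
Qed.

Lemma cgauss_moment2 w v : 0 < complex.Re w ->
  2 * w * cint mu (fun x => (x ^+ 2)%:C * cgauss w v x) =
  cint mu (cgauss w v) + v * cint mu (fun x => x%:C * cgauss w v x).
Proof.
move=> w0; have i0 := cintegrable_cgauss v w0; have i1 := cintegrable_cgauss1 v w0.
have i2 := cintegrable_cgauss2 v w0.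
pose f x := cgauss w v x + (v * (x%:C * cgauss w v x)
  + - (2 * w) * ((x ^+ 2)%:C * cgauss w v x)).
have ia : cintegrable mu (fun x => - (2 * w) * ((x ^+ 2)%:C * cgauss w v x)).
  exact: cintegrable_cstM.
have ib : cintegrable mu (fun x => v * (x%:C * cgauss w v x)).
  exact: cintegrable_cstM.
have ic : cintegrable mu (fun x => v * (x%:C * cgauss w v x)
  + - (2 * w) * ((x ^+ 2)%:C * cgauss w v x)) by exact: cintegrableD.
have : cint mu f = 0.
  apply: (@cint_derive_eq0 (fun x => x%:C * cgauss w v x) f
    ((1 + 4 / complex.Re w) * expR (modulus v ^+ 2 / complex.Re w))).
  - move=> x; apply: cderive_eq (cderiveM (cderive_id x) (cderive_cgauss w v x)) _.
    by rewrite /f expr2 rmorphM; ring.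
  - have -> : f = fun x => cgauss w v x + (v * (x%:C * cgauss w v x)
        + - (2 * w) * (x%:C * (x%:C * cgauss w v x))).
      by apply/funext => x; rewrite /f expr2 rmorphM; ring.
    move=> x; eexists; apply: cderiveD; first exact: cderive_cgauss.
    apply: cderiveD; apply: cderive_cstM.
      by apply: cderiveM; [exact: cderive_id|exact: cderive_cgauss].
    apply: cderiveM; first exact: cderive_id.
    by apply: cderiveM; [exact: cderive_id|exact: cderive_cgauss].
  - exact: cintegrableD.
  - move=> x; rewrite -modulus_real -modulusM mulrA -rmorphM -expr2.
    apply: cgauss_bounded => //.
    by rewrite modulus_real mul1r ger0_norm ?sqr_ge0// lerDr.
rewrite !cintD// !cint_cstM// => h.
by apply/eqP; rewrite -subr_eq0 -oppr_eq0 opprB -addrA -mulNr h.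
Qed.

(* In w the derivative of [cint mu (cgauss w 0)] is minus the second moment,
   so by [cgauss_moment2] the quantity below stays constant as the imaginary
   part of w varies. *)
Lemma cint_cgauss0_sqr w : 0 < complex.Re w ->
  w * cint mu (cgauss w 0) ^+ 2 = pi%:C.
Proof.
move=> w0; pose W (t : R) : R[i] := complex.Re w +i* t.
have W0 t : 0 < complex.Re (W t) by [].
pose J t := cint mu (cgauss (W t) 0).
pose M t := cint mu (fun x => (x ^+ 2)%:C * cgauss (W t) 0 x).
have dJ t : cderive J t (- 'i%C * M t).
  rewrite -cint_cstM; last exact: cintegrable_cgauss2.
  apply: (@cderive_under_integral (fun t => cgauss (W t) 0)
    (fun t x => - 'i%C * ((x ^+ 2)%:C * cgauss (W t) 0 x)) t (t - 1) (t + 1)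
    (gauss_bound (complex.Re w) 0)).
  - by rewrite ltrBlDr ltrDl ltr01.
  - by move=> l; exact: cintegrable_cgauss.
  - move=> l x; apply: cderive_eq.
      have -> : (fun s => cgauss (W s) 0 x) =
          fun s => cexp ((- (x ^+ 2)%:C) * ((complex.Re w)%:C + 'i%C * s%:C)).
        apply/funext => s; congr cexp; apply: complex_eqP => /=; ring.
      apply: cderive_cexp; apply: cderive_cstM; apply: cderiveD.
        exact: cderive_cst.
      by apply: cderive_cstM; exact: cderive_id.
    rewrite /cgauss; have -> : (- (x ^+ 2)%:C) * ((complex.Re w)%:C + 'i%C * l%:C) =
        - (W l * (x ^+ 2)%:C) + 0 * x%:C by apply: complex_eqP => /=; ring.
    by ring.
  - exact: gauss_bound_ge0.
  - exact: integrable_gauss_bound.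
  - move=> l x _; rewrite modulusM.
    have -> : modulus (- 'i%C) = 1 :> R.
      by rewrite modulusN modulusE /= expr0n/= expr1n add0r sqrtr1.
    rewrite mul1r -[leRHS]mul1r.
    have := @modulus_cgaussM_le (W l) 0 (x ^+ 2)%:C x 1 ler01.
    rewrite modulus0; apply.
    by rewrite modulus_real mul1r ger0_norm ?sqr_ge0// lerDr.
have dW t : cderive W t 'i%C.
  by split; [exact: is_derive_cst|exact: is_derive_id].
(* Working with the square avoids choosing a branch of the square root of pi / w; on the plane only
   the square occurs. *)
have cst t : W t * J t ^+ 2 = W 0 * J 0 ^+ 2.
  apply: (@cderive0_cst _ (fun t => W t * J t ^+ 2)) => s.
  under eq_fun do rewrite expr2.
  apply: cderive_eq; first by apply: cderiveM (dW s) (cderiveM (dJ s) (dJ s)).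
  have := @cgauss_moment2 (W s) 0 (W0 s); rewrite mul0r addr0 -/(J s) -/(M s) => <-.
  by ring.
have Ww : w = W (complex.Im w) by rewrite /W; case: (w).
rewrite {1 2}Ww -/(J (complex.Im w)) cst.
have -> : J 0 = (Num.sqrt (pi / complex.Re w))%:C.
  have [_ <-] := gaussian_integral w0.
  have E : cgauss (W 0) 0 = fun x => (expR (- (complex.Re w * x ^+ 2)))%:C.
    apply/funext => x; rewrite /cgauss -cexp_real; congr cexp; apply: complex_eqP => /=; ring.
  by rewrite /J E; apply: complex_eqP => //=; rewrite /Rintegral integral0.
rewrite expr2 -rmorphM -expr2 sqr_sqrtr ?divr_ge0 ?pi_ge0// ?ltW//.
have wn0 : complex.Re w != 0 by rewrite gt_eqF.
by apply: complex_eqP; rewrite /=; [field|ring].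
Qed.

(** A differential equation replaces the shift of contour. Along t v the integral H satisfies H' =
    (v^2 / (2 w)) t H by [cgauss_moment1], so multiplying by the integrating factor [g] makes it
    constant; compare t = 1 with t = 0. *)
Lemma cint_cgauss w v : 0 < complex.Re w ->
  cint mu (cgauss w v) = cint mu (cgauss w 0) * cexp (v ^+ 2 / (4 * w)).
Proof.
move=> w0.
have wn0 : w != 0 by apply: contraTneq w0 => ->; rewrite ltxx.
pose H (t : R) := cint mu (cgauss w (t%:C * v)).
pose M (t : R) := cint mu (fun x => x%:C * cgauss w (t%:C * v) x).
have dH (t : R) : cderive H t (v * M t).
  rewrite -cint_cstM; last exact: cintegrable_cgauss1.
  (* The coefficient |t| + 1 bounds |l| for every l between t - 1 and t + 1, so one dominating
     function serves the whole neighbourhood. *)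
  apply: (@cderive_under_integral (fun t => cgauss w (t%:C * v))
    (fun t x => v * (x%:C * cgauss w (t%:C * v) x)) t (t - 1) (t + 1)
    (fun x => modulus v * gauss_bound (complex.Re w) ((`|t| + 1) * modulus v) x)).
  - by rewrite ltrBlDr ltrDl ltr01.
  - by move=> l; exact: cintegrable_cgauss.
  - move=> l x; apply: cderive_eq.
      have -> : (fun s : R => cgauss w (s%:C * v) x) =
          fun s : R => cexp (- (w * (x ^+ 2)%:C) + v * x%:C * s%:C).
        by apply/funext => s; congr cexp; ring.
      apply: cderive_cexp; apply: cderiveD; first exact: cderive_cst.
      by apply: cderive_cstM; exact: cderive_id.
    rewrite /cgauss; have -> : - (w * (x ^+ 2)%:C) + v * x%:C * l%:C =
        - (w * (x ^+ 2)%:C) + l%:C * v * x%:C by ring.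
    by ring.
  - by move=> x; rewrite mulr_ge0 ?modulus_ge0 ?gauss_bound_ge0.
  - rewrite /comp; under eq_fun do rewrite EFinM.
    by apply: integrableZl => //; exact: integrable_gauss_bound.
  - move=> l x /andP[tl lt]; rewrite modulusM ler_wpM2l ?modulus_ge0//.
    apply: (le_trans (modulus_cgaussM_le w _ ler01 (modulus_le_1Dsqr x))).
    rewrite mul1r /gauss_bound ler_wpM2l ?addr_ge0 ?sqr_ge0//.
    rewrite ler_expR lerD2l ler_wpM2r// modulusM modulus_real.
    rewrite ler_wpM2r ?modulus_ge0// -lerBlDl.
    rewrite (le_trans (lerB_dist _ _))// ler_norml.
    by apply/andP; split; lra.
pose g (t : R) := cexp (- (v ^+ 2 / (4 * w)) * (t%:C * t%:C)).
have dg (t : R) : cderive g t (- (v ^+ 2 / (4 * w)) * (2 * t%:C) * g t).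
  apply: cderive_eq; first apply: cderive_cexp.
    by apply: cderive_cstM; apply: cderiveM; exact: cderive_id.
  by rewrite /g; ring.
have cst (t : R) : g t * H t = g 0 * H 0.
  apply: (@cderive0_cst _ (fun t => g t * H t)) => s.
  apply: cderive_eq; first by apply: cderiveM (dg s) (dH s).
  have := cgauss_moment1 (s%:C * v) w0; rewrite -/(H s) -/(M s) => h.
  have -> : M s = s%:C * v * H s / (2 * w) by rewrite -h; field.
  by field.
have := cst 1.
rewrite /g /H !rmorph1 !rmorph0 !mul0r !mulr0 cexp0 !mul1r !mulr1 => <-.
by rewrite mulrAC -cexpD addNr cexp0 mul1r.
Qed.

End gaussian1.

(** * Gaussian integrals on the plane *)

Section product_sigma_finite_measure.
Context d1 d2 (T1 : measurableType d1) (T2 : measurableType d2) (R : realType).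
Variable m1 : {sigma_finite_measure set T1 -> \bar R}.
Variable m2 : {sigma_finite_measure set T2 -> \bar R}.

(** Both exhaustions are taken increasing, so that the diagonal rectangles F n x G n already cover
    the product. *)
Lemma sigma_finite_product : sigma_finite setT (m1 \x m2)%E.
Proof.
have /sigma_finiteP[F [FT ndF Foo]] := sigma_finiteT m1.
have /sigma_finiteP[G [GT ndG Goo]] := sigma_finiteT m2.
exists (fun n => F n `*` G n) => [|n].
  apply/esym; rewrite -subTset => -[x y] _.
  have [i _ Fx] : (\bigcup_k F k) x by rewrite -FT.
  have [j _ Gy] : (\bigcup_k G k) y by rewrite -GT.
  exists (maxn i j) => //; split => /=.
    exact: (subsetPset _ _ (ndF _ _ (leq_maxl i j))).
  exact: (subsetPset _ _ (ndG _ _ (leq_maxr i j))).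
have [mF F1] := Foo n; have [mG G1] := Goo n.
split; first exact: measurableX.
by rewrite product_measure1E// lte_mul_pinfty// ge0_fin_numE.
Qed.

(* The library's sigma-finite structure on m1 \x m2 cannot be inferred: the one
   for pairs of subprobabilities takes precedence. *)
Definition product_sigma_finite : {sigma_finite_measure set (T1 * T2)%type -> \bar R} :=
  HB.pack (m1 \x m2)%E
    (Measure_isSigmaFinite.Build _ _ _ (m1 \x m2)%E sigma_finite_product).
End product_sigma_finite_measure.
Section gaussian2.
Context {R : realType}.
Notation mu := (@lebesgue_measure R).
Notation T2 := (measurableTypeR R * measurableTypeR R)%type.

(** Convertible to [leb2], but carrying the structure under which Fubini's theorem applies to pairs
    of points of the plane. *)
Definition leb2_sfinite := product_sigma_finite mu mu.

Definition gauss2 (w v1 v2 : R[i]) (x : R * R) : R[i] :=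
  cexp (- (w * (dot2 x x)%:C) + (v1 * x.1%:C + v2 * x.2%:C)).

Lemma gauss2E w v1 v2 x :
  gauss2 w v1 v2 x = cgauss w v1 x.1 * cgauss w v2 x.2.
Proof.
rewrite /gauss2 /cgauss -cexpD; congr cexp.
by rewrite /dot2 -!expr2 rmorphD; ring.
Qed.

(** The right-hand side is a real part of a [gauss2], so that [cint_gauss2] also yields L1 norms. *)
Lemma modulus_gauss2 w v1 v2 x : modulus (gauss2 w v1 v2 x) =
  complex.Re (gauss2 (complex.Re w)%:C (complex.Re v1)%:C (complex.Re v2)%:C x).
Proof.
rewrite modulus_cexp Re_cexp (_ : complex.Im _ = 0); last by rewrite !ReImE /=; ring.
by rewrite cos0 mulr1; congr expR; rewrite !ReImE /=; ring.
Qed.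

Lemma gauss2M w v1 v2 w' v1' v2' x :
  gauss2 w v1 v2 x * gauss2 w' v1' v2' x = gauss2 (w + w') (v1 + v1') (v2 + v2') x.
Proof. by rewrite -cexpD; congr cexp; ring. Qed.

Lemma conj_gauss2 w v1 v2 x : (gauss2 w v1 v2 x)^*%C = gauss2 w^*%C v1^*%C v2^*%C x.
Proof.
rewrite cexp_conj; congr cexp.
case: w v1 v2 x => [a b] [c d] [e f] [x1 x2].
by apply: complex_eqP => /=; ring.
Qed.

Lemma cmeasurable_gauss2 w v1 v2 : cmeasurable (gauss2 w v1 v2 : T2 -> R[i]).
Proof.
rewrite (_ : gauss2 _ _ _ = fun x => cgauss w v1 x.1 * cgauss w v2 x.2).
  apply: cmeasurableM.
    exact: (@cmeasurable_fst _ _ (measurableTypeR R) (measurableTypeR R) R _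
      (cmeasurable_cgauss w v1)).
  exact: (@cmeasurable_snd _ _ (measurableTypeR R) (measurableTypeR R) R _
    (cmeasurable_cgauss w v2)).
by apply/funext => x; exact: gauss2E.
Qed.

Lemma cintegrable_gauss2 w v1 v2 : 0 < complex.Re w ->
  cintegrable leb2_sfinite (gauss2 w v1 v2).
Proof.
move=> w0; rewrite (_ : gauss2 _ _ _ = fun x => cgauss w v1 x.1 * cgauss w v2 x.2).
  by apply: cintegrable_prod; exact: cintegrable_cgauss.
by apply/funext => x; exact: gauss2E.
Qed.

Lemma cint_gauss2 w v1 v2 : 0 < complex.Re w ->
  cint leb2_sfinite (gauss2 w v1 v2) = pi%:C / w * cexp ((v1 ^+ 2 + v2 ^+ 2) / (4 * w)).
Proof.
move=> w0; rewrite (_ : gauss2 _ _ _ = fun x => cgauss w v1 x.1 * cgauss w v2 x.2).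
  rewrite cint_prod; try exact: cintegrable_cgauss.
  rewrite (cint_cgauss v1 w0) (cint_cgauss v2 w0) mulrACA -cexpD -mulrDl.
  have wn0 : w != 0 by apply: contraTneq w0 => ->; rewrite ltxx.
  by congr (_ * _); rewrite -(cint_cgauss0_sqr w0); field.
by apply/funext => x; exact: gauss2E.
Qed.

Lemma fourier_cint (h : R * R -> R[i]) z :
  fourier h z = cint leb2_sfinite (fun x => cexp (0 +i* (- dot2 x z)) * h x).
Proof. by rewrite /fourier; under eq_fun do rewrite expiE. Qed.

(** The character only shifts the linear coefficients by - i z, which is why these are allowed to be
    complex. *)
Lemma fourier_gauss2 w v1 v2 z : 0 < complex.Re w ->
  fourier (gauss2 w v1 v2) z = pi%:C / w *
  cexp (((v1 - 'i%C * z.1%:C) ^+ 2 + (v2 - 'i%C * z.2%:C) ^+ 2) / (4 * w)).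
Proof.
move=> w0; rewrite fourier_cint -cint_gauss2//; congr cint; apply/funext => x.
rewrite /gauss2 -cexpD; congr cexp.
case: w v1 v2 x z {w0} => [a b] [c d] [e f] [x1 x2] [z1 z2]; rewrite /dot2.
by apply: complex_eqP => /=; ring.
Qed.

End gaussian2.

(** * Duality for the Fourier transform *)

Section fourier_duality.
Context {R : realType}.
Notation T2 := (measurableTypeR R * measurableTypeR R)%type.
Notation leb := (@leb2_sfinite R).
Implicit Types h k : R * R -> R[i].

Lemma cmeasurable_character :
  cmeasurable (fun z : T2 * T2 => cexp (0 +i* (- dot2 z.1 z.2)) : R[i]).
Proof.
apply: cmeasurable_cexp; split => /=; first exact: measurable_cst.
apply: measurable_funN; rewrite /dot2.
have m11 : measurable_fun setT (fun z : T2 * T2 => z.1.1).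
  exact: (measurableT_comp (measurable_fst : measurable_fun setT (@fst _ _))).
have m12 : measurable_fun setT (fun z : T2 * T2 => z.1.2).
  exact: (measurableT_comp (measurable_snd : measurable_fun setT (@snd _ _))).
have m21 : measurable_fun setT (fun z : T2 * T2 => z.2.1).
  exact: (measurableT_comp (measurable_fst : measurable_fun setT (@fst _ _))).
have m22 : measurable_fun setT (fun z : T2 * T2 => z.2.2).
  exact: (measurableT_comp (measurable_snd : measurable_fun setT (@snd _ _))).
by apply: measurable_funD; exact: measurable_funM.
Qed.

Lemma modulus_character (t : R) : modulus (cexp (0 +i* t)) = 1.
Proof. by rewrite modulus_cexp expR0. Qed.

Lemma cintegrable_character h z : cintegrable leb h ->
  cintegrable leb (fun x => cexp (0 +i* (- dot2 x z)) * h x).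
Proof.
move=> /cintegrableP[mh ih]; apply/cintegrableP; split.
  apply: cmeasurableM => //.
  have [m1 m2] := cmeasurable_character.
  by split; [apply: (measurable_fun_pair1 z m1)|apply: (measurable_fun_pair1 z m2)].
by under eq_fun do rewrite modulusM modulus_character mul1r.
Qed.

Lemma cintegrable_kernel h k : cintegrable leb h -> cintegrable leb k ->
  cintegrable (leb \x leb)%E
    (fun z => cexp (0 +i* (- dot2 z.1 z.2)) * (h z.1 * k z.2)).
Proof.
move=> ih ik; have /cintegrableP[mhk ihk] := cintegrable_prod ih ik.
apply/cintegrableP; split.
  by apply: cmeasurableM => //; exact: cmeasurable_character.
by under eq_fun do rewrite modulusM modulus_character mul1r.
Qed.

Lemma fourier_inner1 h k x :
  cintegrable leb k ->
  cint leb (fun z => cexp (0 +i* (- dot2 x z)) * (h x * k z)) = h x * fourier k x.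
Proof.
move=> ik; rewrite fourier_cint -cint_cstM.
  by apply: eq_cint => z; rewrite mulrCA /dot2 (mulrC x.1) (mulrC x.2).
exact: cintegrable_character.
Qed.

Lemma fourier_inner2 h k z :
  cintegrable leb h ->
  cint leb (fun x => cexp (0 +i* (- dot2 x z)) * (h x * k z)) = fourier h z * k z.
Proof.
move=> ih; rewrite fourier_cint mulrC -cint_cstM.
  by apply: eq_cint => x; ring.
exact: cintegrable_character.
Qed.

(** Both sides are iterated integrals of exp (- i x.z) h(x) k(z), which is integrable on the product
    because the character is unimodular. *)
Lemma cint_fourierM h k : cintegrable leb h -> cintegrable leb k ->
  cint leb (fun z => fourier h z * k z) = cint leb (fun x => h x * fourier k x).
Proof.
move=> ih ik; have ihk := cintegrable_kernel ih ik.
have [_ e1] := cint_fubini1 ihk; have [_ e2] := cint_fubini2 ihk.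
transitivity (cint leb (fun y => cint leb
    (fun x => cexp (0 +i* (- dot2 x y)) * (h x * k y)))).
  by apply: eq_cint => y; rewrite fourier_inner2.
rewrite -e2 e1; apply: eq_cint => x /=.
by rewrite fourier_inner1.
Qed.

Lemma cintegrable_fourierM h k : cintegrable leb h -> cintegrable leb k ->
  cintegrable leb (fun z => fourier h z * k z).
Proof.
move=> ih ik; have ihk := cintegrable_kernel ih ik.
have [+ _] := cint_fubini2 ihk.
by under eq_fun do rewrite fourier_inner2//.
Qed.

(* [fourier h] is a parametric integral: multiplying by a positive integrable
   Gaussian makes Fubini's theorem applicable. *)
Lemma cmeasurable_fourier h : cintegrable leb h -> cmeasurable (fourier h : T2 -> R[i]).
Proof.
move=> ih.
have ig : cintegrable leb (gauss2 1 0 0) by apply: cintegrable_gauss2; rewrite /= ltr01.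
have m1 := cintegrable_measurable (cintegrable_fourierM ih ig).
have := cmeasurableM m1 (cmeasurable_gauss2 (-1) 0 0).
under eq_fun do rewrite -mulrA gauss2M subrr addr0.
have -> : gauss2 (0 : R[i]) 0 0 = fun=> 1.
  by apply/funext => x; rewrite /gauss2 !mul0r oppr0 !addr0 cexp0.
by under eq_fun do rewrite mulr1.
Qed.

End fourier_duality.

(** * Norms and pairings in the Lebesgue spaces *)

Section Lp_pairing.
Context {R : realType}.
Notation T2 := (measurableTypeR R * measurableTypeR R)%type.
Notation leb := (@leb2_sfinite R).
Implicit Types f g h k : R * R -> R[i].

Lemma LpnormC_ge0 p f : (0 <= LpnormC p f)%E.
Proof. exact: Lnorm_ge0. Qed.

Lemma LpnormC1 f : LpnormC 1%:E f = (\int[leb]_x (modulus (f x))%:E)%E.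
Proof.
rewrite /LpnormC Lnorm1; apply: eq_integral => x _ /=.
by rewrite ger0_norm// modulus_ge0.
Qed.

Lemma sqr_LpnormC2 f :
  (LpnormC 2%:E f `^ 2 = \int[leb]_x (modulus (f x) ^+ 2)%:E)%E.
Proof.
rewrite /LpnormC poweR_Lnorm ?pnatr_eq0//; apply: eq_integral => x _ /=.
by rewrite ger0_norm ?modulus_ge0// powR_mulrn// modulus_ge0.
Qed.

Lemma LpnormC2E f :
  (LpnormC 2%:E f = (\int[leb]_x (modulus (f x) ^+ 2)%:E) `^ 2^-1)%E.
Proof.
rewrite -sqr_LpnormC2 -poweRrM divff ?pnatr_eq0// poweRe1//.
exact: LpnormC_ge0.
Qed.

Lemma in_Lp1P f : in_Lp 1%:E f <-> cintegrable leb f.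
Proof.
split=> [[f1 f2 f3]|/cintegrableP[[f1 f2] f3]].
  apply/cintegrableP; split; first by split.
  apply/integrableP; split.
    by apply/measurable_EFinP; apply: measurable_modulus; split.
  move: f3; rewrite LpnormC1; apply: le_lt_trans.
  by rewrite le_eqVlt; apply/orP; left; apply/eqP; apply: eq_integral => x _ /=;
    rewrite ger0_norm// modulus_ge0.
split=> //; rewrite LpnormC1; have /integrableP[_] := f3; apply: le_lt_trans.
by rewrite le_eqVlt; apply/orP; left; apply/eqP; apply: eq_integral => x _ /=;
  rewrite ger0_norm// modulus_ge0.
Qed.

(** Square integrability becomes integrability of a product, which expands by linearity: for sums of
    Gaussians only products of two Gaussians remain. *)
Lemma in_Lp2P f : in_Lp 2%:E f <->
  cmeasurable (f : T2 -> R[i]) /\ cintegrable leb (fun x => f x * (f x)^*%C).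
Proof.
have E x : modulus (f x * (f x)^*%C) = modulus (f x) ^+ 2.
  by rewrite modulusM modulus_conj expr2.
have absE : (\int[leb]_x `|(modulus (f x * (f x)^*%C))%:E| =
    \int[leb]_x (modulus (f x) ^+ 2)%:E)%E.
  by apply: eq_integral => x _ /=; rewrite E ger0_norm// sqr_ge0.
split=> [[f1 f2 f3]|[[f1 f2] /cintegrableP[_ f3]]].
  have mf : cmeasurable (f : T2 -> R[i]) by split.
  split=> //; apply/cintegrableP.
  have mff : cmeasurable (fun x : T2 => f x * (f x)^*%C).
    by apply: cmeasurableM => //; exact: cmeasurable_conj.
  split=> //; apply/integrableP; split.
    by apply/measurable_EFinP; exact: measurable_modulus.
  by rewrite absE -sqr_LpnormC2 poweR_lty.
split=> //; rewrite LpnormC2E; have /integrableP[_] := f3.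
by rewrite absE => h; rewrite poweR_lty.
Qed.

Lemma hoelder_pairing f g :
  cmeasurable (f : T2 -> R[i]) -> cmeasurable (g : T2 -> R[i]) ->
  (LpnormC 2%:E f < +oo)%E -> (LpnormC 2%:E g < +oo)%E ->
  cintegrable leb (fun x => f x * g x) /\
  ((modulus (cint leb (fun x => f x * g x)))%:E <=
   LpnormC 2%:E f * LpnormC 2%:E g)%E.
Proof.
move=> mf mg f2 g2.
have mfg : cmeasurable (fun x : T2 => f x * g x) by exact: cmeasurableM.
have H : (\int[leb]_x (modulus (f x * g x))%:E <=
    LpnormC 2%:E f * LpnormC 2%:E g)%E.
  have := @hoelder _ _ _ leb (fun x => modulus (f x)) (fun x => modulus (g x)) 2 2
    (measurable_modulus mf) (measurable_modulus mg) (ltr0n _ 2) (ltr0n _ 2).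
  have -> : (2^-1 + 2^-1 = 1 :> R)%R by lra.
  move=> /(_ erefl); apply: le_trans; rewrite Lnorm1 le_eqVlt.
  apply/orP; left; apply/eqP; apply: eq_integral => x _ /=.
  by rewrite modulusM ger0_norm// mulr_ge0 ?modulus_ge0.
have ifg : cintegrable leb (fun x => f x * g x).
  apply/cintegrableP; split=> //; apply/integrableP; split.
    by apply/measurable_EFinP; exact: measurable_modulus.
  under eq_integral do rewrite /= ger0_norm ?modulus_ge0//.
  by apply: (le_lt_trans H); rewrite lte_mul_pinfty ?LpnormC_ge0// ge0_fin_numE ?LpnormC_ge0.
split=> //; apply: le_trans H.
have im := integrable_modulus ifg.
rewrite -[leRHS]fineK; last exact: integrable_fin_num.
by rewrite lee_fin; exact: modulus_cint.
Qed.

(** A positive upper bound [M] stands for the L1 norm of [k], so that the right-hand side is +oo,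
    and not 0 times +oo, when [g] is essentially unbounded. *)
Lemma Linfty_pairing g k (M : R) : cmeasurable (g : T2 -> R[i]) ->
  cintegrable leb k -> 0 < M -> \int[leb]_x modulus (k x) <= M ->
  ((modulus (cint leb (fun x => g x * k x)))%:E <= M%:E * LpnormC +oo g)%E.
Proof.
move=> mg ik M0 kM.
have [->|] := eqVneq (LpnormC +oo g) +oo%E.
  by rewrite gt0_muley ?lte_fin// leey.
move=> goo.
have : (LpnormC +oo g)%E \is a fin_num.
  by rewrite ge0_fin_numE ?LpnormC_ge0// ltey.
have := LpnormC_ge0 +oo g.
case E : (LpnormC +oo g) => [r| |]// r0 _; rewrite lee_fin in r0.
have gr : {ae leb, forall x, modulus (g x) <= r}.
  move: E; rewrite /LpnormC unlock /Lnorm; case: ifPn => [_ E|].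
    have := ess_sup_ge (leb2 R) (abse \o (fun x => (modulus (g x))%:E)).
    rewrite E.
    by apply: filterS => x /=; rewrite lee_fin ger0_norm// modulus_ge0.
  (* The norm has a default value when the whole space is null; every property then holds almost
     everywhere. *)
  rewrite -leNgt => leb0 _; exists setT; split => //.
  by apply/eqP; rewrite eq_le leb0 measure_ge0.
have mk := cintegrable_measurable ik.
have mgk : cmeasurable (fun x : T2 => g x * k x) by exact: cmeasurableM.
have H : (\int[leb]_x (modulus (g x * k x))%:E <= (r * M)%:E)%E.
  apply: (@le_trans _ _ (\int[leb]_x (r * modulus (k x))%:E)%E).
    apply: ae_ge0_le_integral => //.
    - by move=> x _; rewrite lee_fin modulus_ge0.
    - by apply/measurable_EFinP; exact: measurable_modulus.
    - by move=> x _; rewrite lee_fin mulr_ge0 ?modulus_ge0.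
    - by apply/measurable_EFinP; apply: measurable_funM => //; exact: measurable_modulus.
    - have Fae := ae_filter_ringOfSetsType leb.
      by apply: filterS gr => x gx _; rewrite lee_fin modulusM ler_wpM2r ?modulus_ge0.
  under eq_integral do rewrite EFinM.
  rewrite integralZl//; last exact: integrable_modulus.
  rewrite EFinM lee_wpmul2l ?lee_fin// -[leLHS]fineK; first by rewrite lee_fin.
  by apply: integrable_fin_num => //; exact: integrable_modulus.
have igk : cintegrable leb (fun x => g x * k x).
  apply/cintegrableP; split=> //; apply/integrableP; split.
    by apply/measurable_EFinP; exact: measurable_modulus.
  under eq_integral do rewrite /= ger0_norm ?modulus_ge0//.
  by apply: (le_lt_trans H); rewrite ltry.
rewrite -EFinM mulrC; apply: le_trans H.
have im := integrable_modulus igk.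
rewrite -[leRHS]fineK; last exact: integrable_fin_num.
by rewrite lee_fin; exact: modulus_cint.
Qed.

End Lp_pairing.

(** * The multiplication formula in L_2 *)

Section fourier_L2.
Context {R : realType}.
Notation T2 := (measurableTypeR R * measurableTypeR R)%type.
Notation leb := (@leb2_sfinite R).
Implicit Types f g h k : R * R -> R[i].

(** The formula holds exactly for each approximant [h n]. By Hoelder's inequality the two errors are
    at most the norms of h n - f and of its transform minus F, times the fixed norms of the
    transform of [k] and of [k]. *)
Lemma fourier_L2_pairing f F k : is_fourier_L2 f F ->
  cintegrable leb k -> in_Lp 2%:E k -> in_Lp 2%:E (fourier k) ->
  cint leb (fun z => F z * k z) = cint leb (fun x => f x * fourier k x).
Proof.
move=> [[f1 f2 fL] [F1 F2 FL] [h [hL hf hF]]] ik [k1 k2 kL] [Fk1 Fk2 FkL].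
have mf : cmeasurable (f : T2 -> R[i]) by split.
have mF : cmeasurable (F : T2 -> R[i]) by split.
have mk : cmeasurable (k : T2 -> R[i]) by split.
have mFk : cmeasurable (fourier k : T2 -> R[i]) by split.
have [iFk _] := hoelder_pairing mF mk FL kL.
have [ifk _] := hoelder_pairing mf mFk fL FkL.
set a := cint leb (fun z => F z * k z); set b := cint leb _.
pose e n := (LpnormC 2%:E (fun z => (fourier (h n) z - F z)%R) * LpnormC 2%:E k +
  LpnormC 2%:E (fun x => (h n x - f x)%R) * LpnormC 2%:E (fourier k))%E.
have ele : \forall n \near \oo, ((modulus (a - b))%:E <= e n)%E.
  near=> n.
  have hn1 : cintegrable leb (h n) by apply/in_Lp1P; case: (hL n).
  have [_ [hn2 hn3 hnL]] := hL n.
  have mh : cmeasurable (h n : T2 -> R[i]) by split.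
  have mhf : cmeasurable (fun x : T2 => h n x - f x).
    by apply: cmeasurableD => //; exact: cmeasurableN.
  have mhF : cmeasurable (fun x : T2 => fourier (h n) x - F x).
    by apply: cmeasurableD; [exact: cmeasurable_fourier|exact: cmeasurableN].
  (* Convergence to 0 makes these norms eventually less than 1, hence finite, as Hoelder's
     inequality requires. *)
  have Lf : (LpnormC 2%:E (fun x => (h n x - f x)%R) < +oo)%E.
    apply: (@lt_trans _ _ 1%E); last exact: ltry.
    by near: n; apply: (hf (fun y => (y < 1)%E)); apply: open_ereal_lt'; exact: lte01.
  have LF : (LpnormC 2%:E (fun x => (fourier (h n) x - F x)%R) < +oo)%E.
    apply: (@lt_trans _ _ 1%E); last exact: ltry.
    by near: n; apply: (hF (fun y => (y < 1)%E)); apply: open_ereal_lt'; exact: lte01.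
  have [i1 H1] := hoelder_pairing mhF mk LF kL.
  have [i2 H2] := hoelder_pairing mhf mFk Lf FkL.
  have E1 : cint leb (fun z => (fourier (h n) z - F z) * k z) =
      cint leb (fun z => fourier (h n) z * k z) - a.
    rewrite -(mulN1r a) /a -cint_cstM// -cintD//.
    - by apply: eq_cint => z; ring.
    - exact: cintegrable_fourierM.
    - exact: cintegrable_cstM.
  have [ihk _] := hoelder_pairing mh mFk hnL FkL.
  have E2 : cint leb (fun z => (h n z - f z) * fourier k z) =
      cint leb (fun z => h n z * fourier k z) - b.
    rewrite -(mulN1r b) /b -cint_cstM// -cintD//.
    - by apply: eq_cint => z; ring.
    - exact: cintegrable_cstM.
  have -> : a - b = cint leb (fun z => (h n z - f z) * fourier k z) -
      cint leb (fun z => (fourier (h n) z - F z) * k z).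
    by rewrite E1 E2 cint_fourierM//; ring.
  rewrite /e addeC; apply: (@le_trans _ _
      ((modulus (cint leb (fun z => (h n z - f z) * fourier k z)))%:E +
      (modulus (cint leb (fun z => (fourier (h n) z - F z) * k z)))%:E)%E).
    by rewrite -EFinD lee_fin (le_trans (modulusD _ _))// modulusN.
  exact: leeD.
have e0 : e n @[n --> \oo] --> 0%E.
  rewrite -[X in _ --> X](adde0 0%E); apply: cvgeD => //.
    rewrite -(mul0e (LpnormC 2%:E k)); apply: cvgeMr => //.
    by rewrite ge0_fin_numE// LpnormC_ge0.
  rewrite -(mul0e (LpnormC 2%:E (fourier k))); apply: cvgeMr => //.
  by rewrite ge0_fin_numE// LpnormC_ge0.
have : ((modulus (a - b))%:E <= 0)%E.
  rewrite -(cvg_lim _ e0)//; apply: lime_ge => //; exact: cvgP e0.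
rewrite lee_fin => ab0; apply/eqP; rewrite -subr_eq0; apply/eqP.
by apply: Normc.eq0_normc; apply: le_anti; apply/andP; split;
  [exact: ab0|exact: (modulus_ge0 (a - b))].
Unshelve. all: end_near. Qed.

Lemma fourier_cstM (c : R[i]) h z : cintegrable leb h ->
  fourier (fun x => c * h x) z = c * fourier h z.
Proof.
move=> ih; rewrite !fourier_cint -cint_cstM; last exact: cintegrable_character.
by apply: eq_cint => x; ring.
Qed.

Lemma fourier_sum n (h : 'I_n -> R * R -> R[i]) z : (forall j, cintegrable leb (h j)) ->
  fourier (fun x => \sum_(j < n) h j x) z = \sum_(j < n) fourier (h j) z.
Proof.
move=> ih; rewrite fourier_cint.
under eq_cint do rewrite mulr_sumr.
rewrite cint_sum; last by move=> j; exact: cintegrable_character.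
by apply: eq_bigr => j _; rewrite fourier_cint.
Qed.

End fourier_L2.

(** * Gaussian packets *)

Section gaussian_packets.
Context {R : realType}.
Notation T2 := (measurableTypeR R * measurableTypeR R)%type.
Notation leb := (@leb2_sfinite R).
Implicit Types (w : R[i]) (b : R).

Lemma Re_gt0_neq0 w : 0 < complex.Re w -> w != 0.
Proof. by apply: contraTneq => ->; rewrite ltxx. Qed.

Lemma modulus_gt0 (z : R[i]) : z != 0 -> 0 < modulus z.
Proof.
move=> z0; rewrite lt_neqAle modulus_ge0 andbT eq_sym.
by apply: contra z0 => /eqP /Normc.eq0_normc ->.
Qed.

Lemma ReV w : complex.Re w^-1 = complex.Re w / modulus w ^+ 2.
Proof. by rewrite sqr_modulus; case: w. Qed.

Lemma Re_inv4_gt0 w : 0 < complex.Re w -> 0 < complex.Re (4 * w)^-1.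
Proof.
move=> w0; rewrite ReV divr_gt0//.
  by rewrite -(rmorph_nat (real_complex R)) cReM /= mul0r subr0 mulr_gt0.
rewrite exprn_gt0// modulus_gt0// mulf_neq0//.
exact: Re_gt0_neq0.
Qed.

(* The inverse Fourier transform of z |-> exp (- w |z|^2 - i b z_1). *)
Definition packet w b (x : R * R) : R[i] :=
  (4 * pi%:C * w)^-1 * cexp (- (b%:C ^+ 2 / (4 * w))) *
  gauss2 (4 * w)^-1 (b%:C / (2 * w)) 0 x.

Lemma cintegrable_packet w b : 0 < complex.Re w -> cintegrable leb (packet w b).
Proof.
move=> w0; apply: cintegrable_cstM; apply: cintegrable_gauss2.
exact: Re_inv4_gt0.
Qed.

Lemma piC_neq0 : pi%:C != 0 :> R[i].
Proof. by apply/eqP => -[]; apply/eqP; rewrite gt_eqF// pi_gt0. Qed.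

Lemma sqr_i : 'i%C * 'i%C = -1 :> R[i].
Proof. by rewrite -expr2 sqr_i. Qed.

Lemma fourier_packet w b z : 0 < complex.Re w ->
  fourier (packet w b) z = gauss2 w (- 'i%C * b%:C) 0 z.
Proof.
move=> w0; have wn0 := Re_gt0_neq0 w0; have pn0 := piC_neq0.
have w4 := Re_inv4_gt0 w0.
rewrite fourier_cstM; last exact: cintegrable_gauss2.
rewrite fourier_gauss2// /gauss2.
rewrite mulrACA -cexpD -[RHS]mul1r; congr (_ * cexp _).
  by move: pn0; move: (pi%:C) => p pn0; field; rewrite pn0 wn0.
(* The product i * i is left unevaluated, so that the identity is one of rational functions in an
   indeterminate i; then i^2 = -1 is used. *)
transitivity (- 'i%C * b%:C * z.1%:C +
    ('i%C * 'i%C) * (w * (z.1%:C * z.1%:C + z.2%:C * z.2%:C))).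
  by field.
by rewrite sqr_i /dot2 !rmorphD !rmorphM; ring.
Qed.

(** Conjugates of packets are packets, so Hermitian inner products reduce to the bilinear pairing of
    [cint_packetM]. *)
Lemma conj_packet w b x : (packet w b x)^*%C = packet w^*%C b x.
Proof.
have conjM (y z : R[i]) : (y * z)^*%C = y^*%C * z^*%C by exact: rmorphM.
have conjN (y : R[i]) : (- y)^*%C = - y^*%C by exact: rmorphN.
rewrite /packet conjM conjM conj_gauss2 cexp_conj conjN.
by rewrite expr2 !(conjM, conjc_inv, conjc_nat, conjc_real).
Qed.

(** With r = Re (1 / (4 w)), the modulus is a multiple of exp (- r |x - (b,0)|^2). For Re w = 1 the
    norm grows with |Im w|, the time away from focus; this is why a packet is used as a test over
    one unit of time only. *)
Lemma L1_packet w b : 0 < complex.Re w ->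
  \int[leb]_x modulus (packet w b x) = modulus w / complex.Re w.
Proof.
move=> w0; have wn0 := Re_gt0_neq0 w0.
have w4 := Re_inv4_gt0 w0.
set r := complex.Re (4 * w)^-1.
have r0 : 0 < r := w4.
have rE : complex.Re (b%:C / (2 * w)) = 2 * b * r.
  have -> : b%:C / (2 * w) = (2 * b)%:C * (4 * w)^-1.
    by rewrite rmorphM rmorph_nat; field.
  by rewrite cReM /= mul0r subr0.
have ig : cintegrable leb (gauss2 r%:C (2 * b * r)%:C 0) by exact: cintegrable_gauss2.
have E x : modulus (packet w b x) =
  (4 * pi * modulus w)^-1 * expR (- (b ^+ 2 * r)) *
  complex.Re (gauss2 r%:C (2 * b * r)%:C 0 x).
  rewrite /packet 2!modulusM modulus_gauss2 rE; congr (_ * _ * _).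
    rewrite modulusV !modulusM modulus_real ger0_norm ?pi_ge0//.
    by rewrite -(rmorph_nat (real_complex R)) modulus_real ger0_norm.
  rewrite modulus_cexp; congr expR.
  by rewrite cReN -rmorphXn cReM /= mul0r subr0.
under eq_Rintegral do rewrite E.
rewrite RintegralZl//; last by case: ig.
have -> : \int[leb]_x complex.Re (gauss2 r%:C (2 * b * r)%:C 0 x) =
    complex.Re (cint leb (gauss2 r%:C (2 * b * r)%:C 0)) by [].
rewrite cint_gauss2//.
have rn0 : r != 0 by rewrite gt_eqF.
have -> : ((2 * b * r)%:C ^+ 2 + 0 ^+ 2) / (4 * r%:C) = (b ^+ 2 * r)%:C.
  rewrite !(rmorphM, rmorphXn, rmorph_nat)/=.
  have : r%:C != 0 by apply/eqP => -[]; exact/eqP.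
  by move: (r%:C) => s sn0; field.
rewrite cexp_real -fmorphV -!rmorphM /= mulrACA -expRD addNr expR0 mulr1.
rewrite /r ReV -(rmorph_nat (real_complex R)) modulusM modulus_real ger0_norm//.
rewrite cReM /= mul0r subr0.
have mw : modulus w != 0 by rewrite gt_eqF// modulus_gt0.
have := @pi_gt0 R; move: pi => p p0; field.
by rewrite mw !gt_eqF.
Qed.

Lemma in_Lp1_packets n (w : 'I_n -> R[i]) (b : 'I_n -> R) :
  (forall j, 0 < complex.Re (w j)) ->
  in_Lp 1%:E (fun x => \sum_(j < n) packet (w j) (b j) x).
Proof.
by move=> w0; apply/in_Lp1P; apply: cintegrable_sum => j; exact: cintegrable_packet.
Qed.

Lemma cintegrable_gauss2_conjM w v1 v2 w' v1' v2' : 0 < complex.Re w ->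
  0 < complex.Re w' ->
  cintegrable leb (fun x => gauss2 w v1 v2 x * (gauss2 w' v1' v2' x)^*%C).
Proof.
move=> w0 w0'; under eq_fun do rewrite conj_gauss2 gauss2M.
apply: cintegrable_gauss2; rewrite cReD addr_gt0//.
by case: (w') w0'.
Qed.

Lemma in_Lp2_gauss2_sum n (c w v1 v2 : 'I_n -> R[i]) :
  (forall j, 0 < complex.Re (w j)) ->
  in_Lp 2%:E (fun x => \sum_(j < n) c j * gauss2 (w j) (v1 j) (v2 j) x).
Proof.
move=> w0; apply/in_Lp2P; split.
  apply: cmeasurable_sum => j; apply: cmeasurableM; first exact: cmeasurable_cst.
  exact: cmeasurable_gauss2.
under eq_fun do rewrite rmorph_sum mulr_suml.
apply: cintegrable_sum => j; under eq_fun do rewrite mulr_sumr.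
apply: cintegrable_sum => l.
under eq_fun do rewrite /= rmorphM mulrACA.
by apply: cintegrable_cstM; exact: cintegrable_gauss2_conjM.
Qed.

Lemma in_Lp2_packets n (w : 'I_n -> R[i]) (b : 'I_n -> R) :
  (forall j, 0 < complex.Re (w j)) ->
  in_Lp 2%:E (fun x => \sum_(j < n) packet (w j) (b j) x).
Proof.
move=> w0; apply: in_Lp2_gauss2_sum => j; exact: Re_inv4_gt0.
Qed.

Lemma in_Lp2_gauss2 w v1 v2 : 0 < complex.Re w -> in_Lp 2%:E (gauss2 w v1 v2).
Proof.
move=> w0; apply/in_Lp2P; split; first exact: cmeasurable_gauss2.
exact: cintegrable_gauss2_conjM.
Qed.

(** The sum lies in both L_1 and L_2, so the constant sequence serves as approximation. *)
Lemma is_fourier_packets n (w : 'I_n -> R[i]) (b : 'I_n -> R) :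
  (forall j, 0 < complex.Re (w j)) ->
  is_fourier_L2 (fun x => \sum_(j < n) packet (w j) (b j) x)
    (fun z => \sum_(j < n) gauss2 (w j) (- 'i%C * (b j)%:C) 0 z).
Proof.
move=> w0.
have f2 := in_Lp2_packets b w0.
split=> //.
  have := @in_Lp2_gauss2_sum n (fun=> 1) w (fun j => - 'i%C * (b j)%:C) (fun=> 0) w0.
  by congr in_Lp; apply/funext => x; apply: eq_bigr => j _; rewrite mul1r.
have L0 (f : R * R -> R[i]) : (forall x, f x = 0) -> LpnormC 2%:E f = 0%E.
  move=> f0; rewrite LpnormC2E.
  under eq_integral do rewrite f0 modulus0 expr0n/=.
  by rewrite integral0 poweR0r// invr_eq0 pnatr_eq0.
exists (fun=> fun x => \sum_(j < n) packet (w j) (b j) x); split.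
- by move=> _; split=> //; exact: in_Lp1_packets.
- rewrite L0; first exact: cvg_cst.
  by move=> x; rewrite subrr.
- rewrite L0; first exact: cvg_cst.
  move=> x; rewrite fourier_sum; last by move=> j; exact: cintegrable_packet.
  by rewrite -sumrB big1// => j _; rewrite fourier_packet// subrr.
Qed.

Lemma expi_gauss2 (t : R) z : expi (t * dot2 z z) = gauss2 (0 -i* t) 0 0 z.
Proof.
rewrite expiE /gauss2; congr cexp.
by rewrite !mul0r !addr0; apply: complex_eqP => /=; ring.
Qed.

(** The multiplier is a Gaussian with parameter - i t, so the evolution only shifts Im w. This
    supplies the existence that keeps [schrodinger] away from its default value. *)
Lemma is_schrodinger_packets n (w : 'I_n -> R[i]) (b : 'I_n -> R) t :
  (forall j, 0 < complex.Re (w j)) ->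
  is_schrodinger t (fun x => \sum_(j < n) packet (w j) (b j) x)
    (fun x => \sum_(j < n) packet (w j + (0 -i* t)) (b j) x).
Proof.
move=> w0; exists (fun z => \sum_(j < n) gauss2 (w j) (- 'i%C * (b j)%:C) 0 z).
split; first exact: is_fourier_packets.
have := @is_fourier_packets n (fun j => w j + (0 -i* t)) b.
have -> : (fun z => expi (t * dot2 z z) *
    \sum_(j < n) gauss2 (w j) (- 'i%C * (b j)%:C) 0 z) =
  (fun z => \sum_(j < n) gauss2 (w j + (0 -i* t)) (- 'i%C * (b j)%:C) 0 z).
  apply/funext => z; rewrite expi_gauss2 mulr_sumr; apply: eq_bigr => j _.
  by rewrite gauss2M add0r addr0 addrC.
by apply => j; rewrite cReD /= addr0.
Qed.

End gaussian_packets.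

(** * Inner products of packets *)

Section packet_pairings.
Context {R : realType}.
Notation T2 := (measurableTypeR R * measurableTypeR R)%type.
Notation leb := (@leb2_sfinite R).
Implicit Types (w : R[i]) (b : R).

(** Fourier inversion for Gaussians, by computation: reversing the sign of i b turns the inverse
    transform into the forward one, up to (2 pi)^2. This is the origin of every factor 4 pi^2
    below. *)
Lemma fourier_gauss2_packet w b x : 0 < complex.Re w ->
  fourier (gauss2 w ('i%C * b%:C) 0) x = (4 * pi%:C * pi%:C) * packet w b x.
Proof.
move=> w0; have wn0 := Re_gt0_neq0 w0; have pn0 := @piC_neq0 R.
rewrite fourier_gauss2// /packet /gauss2 -[X in _ = _ * X]mulrA -cexpD [RHS]mulrA.
congr (_ * cexp _).
  by move: pn0; move: (pi%:C) => p pn0; field; rewrite pn0 wn0.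
transitivity (('i%C * 'i%C) * ((b%:C - x.1%:C) ^+ 2 + x.2%:C ^+ 2) / (4 * w)).
  by field.
by rewrite sqr_i /dot2 !rmorphD !rmorphM; field.
Qed.

Lemma in_Lp2_packet w b : 0 < complex.Re w -> in_Lp 2%:E (packet w b).
Proof.
move=> w0.
rewrite (_ : packet w b = fun x => \sum_(j < 1) packet w b x).
  exact: (in_Lp2_packets (fun=> b) (fun=> w0)).
by apply/funext => x; rewrite big_ord1.
Qed.

Lemma in_Lp2_measurable (f : R * R -> R[i]) : in_Lp 2%:E f -> cmeasurable (f : T2 -> R[i]).
Proof. by case. Qed.

Lemma in_Lp2_lty (f : R * R -> R[i]) : in_Lp 2%:E f -> (LpnormC 2%:E f < +oo)%E.
Proof. by case. Qed.

Lemma cintegrable_in_Lp2M (f g : R * R -> R[i]) : in_Lp 2%:E f -> in_Lp 2%:E g ->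
  cintegrable leb (fun x => f x * g x).
Proof.
move=> f2 g2; apply: (proj1 (hoelder_pairing _ _ _ _));
  [exact: in_Lp2_measurable|exact: in_Lp2_measurable|exact: in_Lp2_lty|exact: in_Lp2_lty].
Qed.

(** One packet is written as a Fourier transform and the transform is moved to the other; the
    product of the two resulting Gaussians has an explicit integral. *)
Lemma cint_packetM w b w' b' : 0 < complex.Re w -> 0 < complex.Re w' ->
  (4 * pi%:C * pi%:C) * cint leb (fun x => packet w b x * packet w' b' x) =
  pi%:C / (w + w') * cexp (- ((b - b')%:C ^+ 2 / (4 * (w + w')))).
Proof.
move=> w0 w0'.
have ww0 : 0 < complex.Re (w + w') by rewrite cReD addr_gt0.
have ip := cintegrable_packet b w0.
have ig : cintegrable leb (gauss2 w' ('i%C * b'%:C) 0) by exact: cintegrable_gauss2.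
rewrite -cint_cstM; last first.
  by apply: cintegrable_in_Lp2M; exact: in_Lp2_packet.
transitivity (cint leb (fun x => packet w b x * fourier (gauss2 w' ('i%C * b'%:C) 0) x)).
  by apply: eq_cint => x; rewrite fourier_gauss2_packet//; ring.
rewrite -cint_fourierM//.
under eq_cint do rewrite fourier_packet// gauss2M addr0.
rewrite cint_gauss2//; congr (_ * cexp _).
have wn0 := Re_gt0_neq0 ww0.
transitivity (('i%C * 'i%C) * ((b%:C - b'%:C) ^+ 2) / (4 * (w + w'))).
  by field.
by rewrite sqr_i rmorphB; field.
Qed.

End packet_pairings.

Section packet_sums.
Context {R : realType}.
Notation T2 := (measurableTypeR R * measurableTypeR R)%type.
Notation leb := (@leb2_sfinite R).
Variables (N : nat) (b : nat -> R).

(** At time t the parameter 1 + i j becomes 1 + i (j - t), which is real at t = j. *)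
Definition packet_sum (x : R * R) : R[i] :=
  \sum_(j < N) packet (1 +i* j%:R) (b j) x.

(** 4 pi^2 times the inner product of two packets whose focusing times differ by s and positions by
    y; 2 + i s is the sum of one parameter and the conjugate of the other. *)
Definition gram (s y : R) : R[i] :=
  pi%:C / (2 +i* s) * cexp (- (y%:C ^+ 2 / (4 * (2 +i* s)))).

Definition row_sum (l : nat) : R[i] :=
  \sum_(j < N) gram (j%:R - l%:R) (b j - b l).

Lemma in_Lp2_packet_sum : in_Lp 2%:E packet_sum.
Proof. by apply: in_Lp2_packets => j /=; rewrite ltr01. Qed.

Lemma cint_packet_sumM l :
  (4 * pi%:C * pi%:C) *
  cint leb (fun x => packet_sum x * packet (1 -i* l%:R) (b l) x) = row_sum l.
Proof.
under eq_cint do rewrite mulr_suml.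
rewrite cint_sum; last first.
  by move=> j; apply: cintegrable_in_Lp2M; apply: in_Lp2_packet; rewrite /= ltr01.
rewrite mulr_sumr; apply: eq_bigr => j _.
by rewrite cint_packetM /= ?ltr01.
Qed.

Lemma packet_sum_norm :
  \int[leb]_x (modulus (packet_sum x) ^+ 2) =
  (4 * pi * pi)^-1 * \sum_(l < N) complex.Re (row_sum l).
Proof.
have cf2 : cint leb (fun x => packet_sum x * (packet_sum x)^*%C) =
    (4 * pi%:C * pi%:C)^-1 * \sum_(l < N) row_sum l.
  have -> : (fun x => packet_sum x * (packet_sum x)^*%C) =
      fun x => \sum_(l < N) packet_sum x * packet (1 -i* l%:R) (b l) x.
    apply/funext => x; rewrite -mulr_sumr; congr (_ * _).
    rewrite /packet_sum (raddf_sum (@conjc R)); apply: eq_bigr => l _.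
    exact: conj_packet.
  rewrite cint_sum; last first.
    move=> l; apply: cintegrable_in_Lp2M; first exact: in_Lp2_packet_sum.
    by apply: in_Lp2_packet; rewrite /= ltr01.
  rewrite mulr_sumr; apply: eq_bigr => l _.
  rewrite -cint_packet_sumM mulrA mulVf ?mul1r//.
  by rewrite !mulf_neq0 ?piC_neq0// pnatr_eq0.
rewrite -Re_sum; have := congr1 (@complex.Re R) cf2.
rewrite -[in X in X * _](rmorph_nat (real_complex R)) -!rmorphM -fmorphV
  cReM /= mul0r subr0 => <-.
by apply: eq_Rintegral => x _; rewrite mulcJ.
Qed.

(* Testing the solution against the packet centred at b l, transported for the
   time theta elapsed since l, costs only a bounded factor in the L1 norm and
   makes the pairing independent of theta. *)
Lemma packet_sum_Linfty (l : nat) (theta : R) g : 0 <= theta <= 1 ->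
  is_schrodinger (l%:R + theta) packet_sum g ->
  ((modulus (row_sum l))%:E <= (8 * pi * pi)%:E * LpnormC +oo g)%E.
Proof.
move=> th [F [Ff Fg]].
pose w : R[i] := 1 +i* theta.
have w0 : 0 < complex.Re w by rewrite /= ltr01.
pose k := gauss2 w ('i%C * (b l)%:C) 0.
have fk : fourier k = fun x => (4 * pi%:C * pi%:C) * packet w (b l) x.
  by apply/funext => x; rewrite fourier_gauss2_packet.
have in2Z (c : R[i]) w' y : 0 < complex.Re w' -> in_Lp 2%:E (fun x => c * packet w' y x).
  move=> w0'; rewrite /packet.
  have := @in_Lp2_gauss2_sum R 1
    (fun=> c * ((4 * pi%:C * w')^-1 * cexp (- (y%:C ^+ 2 / (4 * w')))))
    (fun=> (4 * w')^-1) (fun=> y%:C / (2 * w')) (fun=> 0) (fun=> Re_inv4_gt0 w0').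
  under eq_fun do rewrite big_ord1.
  by under eq_fun do rewrite -mulrA.
have k1 : cintegrable leb k by exact: cintegrable_gauss2.
have k2 : in_Lp 2%:E k by exact: in_Lp2_gauss2.
have fk2 : in_Lp 2%:E (fourier k) by rewrite fk; exact: in2Z.
have e1 := fourier_L2_pairing Fg k1 k2 fk2.
pose k' := gauss2 (1 -i* l%:R) ('i%C * (b l)%:C) 0.
have w0' : 0 < complex.Re (1 -i* l%:R : R[i]) by rewrite /= ltr01.
have fk' : fourier k' = fun x => (4 * pi%:C * pi%:C) * packet (1 -i* l%:R) (b l) x.
  by apply/funext => x; rewrite fourier_gauss2_packet.
have k1' : cintegrable leb k' by exact: cintegrable_gauss2.
have k2' : in_Lp 2%:E k' by exact: in_Lp2_gauss2.
have fk2' : in_Lp 2%:E (fourier k') by rewrite fk'; exact: in2Z.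
have e2 := fourier_L2_pairing Ff k1' k2' fk2'.
(* Moved onto the test Gaussian, the multiplier changes its parameter 1 + i theta into 1 - i l,
   where theta has disappeared. *)
have kk z : expi ((l%:R + theta) * dot2 z z) * k z = k' z.
  rewrite expi_gauss2 /k gauss2M /k' (add0r ('i%C * _)) (addr0 0).
  have -> : 0 -i* (l%:R + theta) + w = 1 -i* l%:R; last by [].
  by rewrite /w; apply: complex_eqP; [rewrite cReD|rewrite cImD]; rewrite /=; ring.
have -> : row_sum l = cint leb (fun x => g x * fourier k x).
  rewrite -e1 -cint_packet_sumM -cint_cstM; last first.
    by apply: cintegrable_in_Lp2M; [exact: in_Lp2_packet_sum|exact: in_Lp2_packet].
  transitivity (cint leb (fun x => packet_sum x * fourier k' x)).
    by apply: eq_cint => x; rewrite fk'; ring.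
  by rewrite -e2; apply: eq_cint => z; rewrite -kk; ring.
have pi0 := @pi_gt0 R.
apply: Linfty_pairing.
- by case: Fg => /in_Lp2_measurable.
- by rewrite fk; apply: cintegrable_cstM; exact: cintegrable_packet.
- by rewrite !mulr_gt0.
rewrite fk; under eq_Rintegral do rewrite modulusM.
rewrite RintegralZl//; last exact: integrable_modulus (cintegrable_packet (b l) w0).
rewrite L1_packet// (_ : complex.Re w = 1)// divr1.
have -> : modulus (4 * pi%:C * pi%:C : R[i]) = 4 * pi * pi.
  by rewrite -(rmorph_nat (real_complex R)) -!rmorphM modulus_real ger0_norm//
    !mulr_ge0// ltW.
(* The factor 2 bounds the L1 norm |1 + i theta| of the test packet for theta in [0, 1]. *)
have -> : 8 * pi * pi = 4 * pi * pi * 2 :> R by ring.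
rewrite ler_pM2l ?mulr_gt0//.
rewrite (le_trans (modulus_le_ReIm _))//= normr1 ger0_norm; lra.
Qed.

End packet_sums.

(** * The walk and its energy *)

Section walk.

Definition digit_step (r : nat) : int := if r == 2%N then -1 else 1.

(** Digits are read from the lowest one. Leading zeros have sign 1, so excess fuel does not change
    the value, and n itself is enough fuel. *)
Fixpoint digit_sign (fuel n : nat) : int :=
  if fuel is k.+1 then digit_step (n %% 4) * digit_sign k (n %/ 4) else 1.

(* (-1) to the number of digits 2 in the base-4 expansion of n *)
Definition walk_sign (n : nat) : int := digit_sign n n.

(** Passing to the next finer scale replaces a step by four steps with signs +, +, -, +. The
    displacement doubles while the time is multiplied by 4: this gives the exponent 1/2. *)
Definition walk (n : nat) : int := \sum_(i < n) walk_sign i.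

(** The partial sums 0, 1, 2, 1 of the pattern +, +, -, +. *)
Definition walk_offset (r : nat) : int :=
  if r == 2%N then 2 else if odd r then 1 else 0.

Lemma digit_sign0 k : digit_sign k 0 = 1.
Proof. by elim: k => //= k ->. Qed.

Lemma digit_sign_fuel k n : (n <= k)%N -> digit_sign k n = walk_sign n.
Proof.
elim/ltn_ind: n k => -[|n] IH [|k] // nk; first by rewrite digit_sign0.
have lt : (n.+1 %/ 4 < n.+1)%N by rewrite ltn_Pdiv.
rewrite /walk_sign /=; congr (_ * _).
by rewrite !IH//; lia.
Qed.

Lemma walk_sign_digit q r : (r < 4)%N ->
  walk_sign (4 * q + r) = digit_step r * walk_sign q.
Proof.
move=> r4; have E : ((4 * q + r) %% 4 = r)%N by lia.
have E' : ((4 * q + r) %/ 4 = q)%N by lia.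
case n0 : (4 * q + r)%N => [|n].
  have -> : q = 0%N by lia.
  by have -> : r = 0%N by lia.
rewrite /walk_sign /= -n0 E E'; congr (_ * _).
by apply: digit_sign_fuel; lia.
Qed.

Lemma walk_sign_pm1 n : walk_sign n = 1 \/ walk_sign n = -1.
Proof.
suff H k : digit_sign k n = 1 \/ digit_sign k n = -1 by exact: H.
elim: k n => [|k IH] n /=; first by left.
by rewrite /digit_step; have [->|->] := IH (n %/ 4)%N; case: ifP => _;
  [right|left|left|right].
Qed.

Lemma walk0 : walk 0 = 0.
Proof. by rewrite /walk big_ord0. Qed.

Lemma walkS n : walk n.+1 = walk n + walk_sign n.
Proof. by rewrite /walk big_ord_recr. Qed.

Lemma walk_steps q : [/\ walk_sign (4 * q) = walk_sign q,
  walk_sign (4 * q).+1 = walk_sign q, walk_sign (4 * q).+2 = - walk_sign q &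
  walk_sign (4 * q).+3 = walk_sign q].
Proof.
have h r : (r < 4)%N -> walk_sign (4 * q + r) = digit_step r * walk_sign q.
  exact: walk_sign_digit.
split; [have := h 0%N isT|have := h 1%N isT|have := h 2%N isT|have := h 3%N isT];
  by rewrite ?addnS ?addn0 /digit_step /= ?mul1r ?mulN1r.
Qed.

Lemma walkM4 q : walk (4 * q) = 2 * walk q.
Proof.
elim: q => [|q IH]; first by rewrite muln0 walk0.
have -> : (4 * q.+1 = (4 * q).+4)%N by lia.
have [h0 h1 h2 h3] := walk_steps q.
by rewrite !walkS h0 h1 h2 h3 IH; ring.
Qed.

Lemma walk_digit q r : (r < 4)%N ->
  walk (4 * q + r) = 2 * walk q + walk_sign q * walk_offset r.
Proof.
have [h0 h1 h2 h3] := walk_steps q.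
case: r => [|[|[|[|//]]]] _; rewrite ?addnS addn0 ?walkS walkM4 ?h0 ?h1 ?h2;
  by rewrite /walk_offset /=; ring.
Qed.

(** Dropping the last digit halves the increment up to two signed offsets of size at most 2, so the
    bounds satisfy c(m + 1) = 2 c(m) + 4 with c(0) = 1, solved by 5 * 2^m - 4. *)
Lemma walk_hoelder m j k : (j <= k <= j + 4 ^ m)%N ->
  `|walk k - walk j| <= 5 * 2 ^+ m - 4.
Proof.
elim: m j k => [|m IH] j k.
  rewrite expn0 => jk; have [->|->] : k = j \/ k = j.+1 by lia.
    by rewrite subrr.
  by rewrite walkS addrAC subrr add0r; have [->|->] := walk_sign_pm1 j.
rewrite expnS => jk.
rewrite (divn_eq k 4) (divn_eq j 4) ![(_ %/ 4 * 4)%N]mulnC.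
have rk : (k %% 4 < 4)%N by lia.
have rj : (j %% 4 < 4)%N by lia.
rewrite !walk_digit//.
have := IH (j %/ 4)%N (k %/ 4)%N; rewrite exprS.
have h02 r : 0 <= walk_offset r <= 2.
  by rewrite /walk_offset; case: ifP => // _; case: ifP.
have hk := h02 (k %% 4)%N; have hj := h02 (j %% 4)%N.
have -> : (j %/ 4 <= k %/ 4 <= j %/ 4 + 4 ^ m)%N by lia.
move=> /(_ erefl); move: (2 ^+ m : int) => P.
by have [->|->] := walk_sign_pm1 (j %/ 4); have [->|->] := walk_sign_pm1 (k %/ 4); lia.
Qed.

(** If 4^(m-1) < k - j <= 4^m, the squared increment is at most 25 * 4^m = 100 * 4^(m-1). *)
Lemma walk_sqr_le j k : (j <= k)%N -> (walk k - walk j) ^+ 2 <= 100 * (k - j)%N%:Z.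
Proof.
move=> jk; have [->|jk'] := eqVneq j k; first by rewrite subrr subnn.
have [k1|k1] := leqP (k - j)%N 1.
  have -> : k = j.+1 by lia.
  rewrite walkS addrAC subrr add0r subSnn.
  by have [->|->] := walk_sign_pm1 j.
have /andP[lo hi] := @up_log_bounds 4 _ isT k1.
set m := up_log 4 (k - j) in lo hi.
have m0 : (0 < m)%N by rewrite up_log_gt0.
have H : `|walk k - walk j| <= 5 * 2 ^+ m - 4 by apply: walk_hoelder; lia.
have H2 : (walk k - walk j) ^+ 2 <= (5 * 2 ^+ m) ^+ 2.
  have [d1 d2] : (0 <= 5 * 2 ^+ m - (walk k - walk j)) /\
      (0 <= 5 * 2 ^+ m + (walk k - walk j)) by lia.
  by have := mulr_ge0 d1 d2; rewrite -subr_sqr subr_ge0.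
apply: (le_trans H2); rewrite exprMn -exprM mulnC exprM.
have -> : (5 : int) ^+ 2 = 25 by [].
have -> : (2 : int) ^+ 2 = 4 by [].
rewrite -(prednK m0) exprS.
have -> : (4 : int) ^+ m.-1 = (4 ^ m.-1)%N%:Z by rewrite -[in RHS]natz natrX.
move: lo; lia.
Qed.

Lemma walk_self_similar m q i : (i < 4 ^ m)%N ->
  walk_sign (4 ^ m * q + i) = walk_sign q * walk_sign i /\
  walk (4 ^ m * q + i) = 2 ^+ m * walk q + walk_sign q * walk i.
Proof.
elim: m i => [|m IH] i.
  rewrite expn0 ltnS leqn0 => /eqP ->; rewrite mul1n addn0 walk0.
  by have -> : walk_sign 0 = 1 by []; split; ring.
rewrite expnS => im.
have ri : (i %% 4 < 4)%N by lia.
have qi : (i %/ 4 < 4 ^ m)%N by lia.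
have [IH1 IH2] := IH _ qi.
have -> : (4 * 4 ^ m * q + i = 4 * (4 ^ m * q + i %/ 4) + i %% 4)%N by lia.
have Ei : (i = 4 * (i %/ 4) + i %% 4)%N by lia.
rewrite [in walk_sign i]Ei [in walk i]Ei !walk_digit// !walk_sign_digit// IH1 IH2 exprS.
by split; ring.
Qed.

End walk.

(** * Lower bound for the sum of the Gram matrix *)

Section energy.
Context {R : realType}.
Implicit Types s y : R.

Lemma sin_ge_lin (x : R) : 0 <= x <= 1 -> cos 1 * x <= sin x.
Proof.
move=> /andP[x0 x1].
have [c + E] := @MVT_segment R sin cos 0 x x0 (fun z _ => is_derive_sin z)
  (continuous_subspaceT (@continuous_sin R)).
rewrite in_itv/= => /andP[c0 cx]; move: E; rewrite sin0 !subr0 => ->.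
have pi1 : 1 <= pi :> R by rewrite (le_trans _ (pi_ge2 R))// ler1n.
have c1 : c <= 1 by exact: le_trans x1.
rewrite ler_wpM2r// leNgt ltr_cos ?in_itv/= ?ler01 ?pi1 ?c0 ?(le_trans c1)//.
by rewrite -leNgt.
Qed.

Lemma Re_gram s y : complex.Re (gram s y) =
  pi / (4 + s ^+ 2) * expR (- (y ^+ 2 / (2 * (4 + s ^+ 2)))) *
  (2 * cos (s * y ^+ 2 / (4 * (4 + s ^+ 2))) +
   s * sin (s * y ^+ 2 / (4 * (4 + s ^+ 2)))).
Proof.
have d0 : 4 + s ^+ 2 != 0 by rewrite gt_eqF// ltr_pwDl// sqr_ge0.
have i2 : (2 +i* s)^-1 = (2 / (4 + s ^+ 2)) -i* (s / (4 + s ^+ 2)).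
  have -> : 4 + s ^+ 2 = 2 ^+ 2 + s ^+ 2 by ring.
  by [].
have E : - (y%:C ^+ 2 / (4 * (2 +i* s))) =
    (- (y ^+ 2 / (2 * (4 + s ^+ 2)))) +i* (s * y ^+ 2 / (4 * (4 + s ^+ 2))).
  rewrite invfM i2 -rmorphXn -(rmorph_nat (real_complex R)) -fmorphV.
  by apply: complex_eqP; rewrite !ReImE /=; field.
rewrite /gram E i2 cReM Re_cexp Im_cexp !ReImE /=.
by move: (cos _) (sin _) (expR _) => C S X; move: pi => p; field.
Qed.

(** The hypothesis keeps the phase phi = |s| y^2 / (4 (4 + s^2)) in [0, 1]: the cosine term is
    nonnegative and dropped, and |s| sin phi >= |s| cos 1 * phi gives the main term. The denominator
    8 comes from the 4 in phi and the lower bound 1/2 of the exponential factor. *)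
Lemma Re_gram_ge s y : y ^+ 2 <= `|s| ->
  pi * cos 1 / 8 * (s ^+ 2 * y ^+ 2 / (4 + s ^+ 2) ^+ 2) <= complex.Re (gram s y).
Proof.
move=> ys; rewrite Re_gram.
have s20 : 0 <= s ^+ 2 := sqr_ge0 s; have y20 : 0 <= y ^+ 2 := sqr_ge0 y.
have D0 : 0 < 4 + s ^+ 2 by rewrite ltr_pwDl.
have pi0 := @pi_gt0 R; have c0 := @cos1_gt0 R.
set D := 4 + s ^+ 2 in D0 *.
pose phi := `|s| * y ^+ 2 / (4 * D).
have phi0 : 0 <= phi.
  by apply: divr_ge0; [exact: mulr_ge0|rewrite mulr_ge0// ltW].
have phi1 : phi <= 1.
  rewrite ler_pdivrMr ?mulr_gt0// mul1r (@le_trans _ _ (`|s| * `|s|))//.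
    by rewrite ler_wpM2l.
  by rewrite -expr2 real_normK ?num_real// /D; lra.
have -> : cos (s * y ^+ 2 / (4 * D)) = cos phi.
  by rewrite /phi; have [_|_] := ger0P s; rewrite // !mulNr cosN.
have -> : s * sin (s * y ^+ 2 / (4 * D)) = `|s| * sin phi.
  by rewrite /phi; have [_|_] := ger0P s; rewrite // !mulNr sinN mulrN opprK.
have cphi : 0 <= cos phi.
  apply: cos_ge0_pihalf; have := pi_ge2 R; lra.
have sphi := @sin_ge_lin phi (introT andP (conj phi0 phi1)).
(* From exp (- u) >= 1 - u and y^2 <= |s| <= 4 + s^2. *)
have X1 : 1 / 2 <= expR (- (y ^+ 2 / (2 * D))).
  apply: le_trans (expR_ge1Dx _).
  have : y ^+ 2 / (2 * D) <= 1 / 2.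
    rewrite ler_pdivrMr ?mulr_gt0//; apply: (le_trans ys).
    have : 0 <= (`|s| - 1) ^+ 2 by exact: sqr_ge0.
    have : s ^+ 2 = `|s| ^+ 2 by rewrite real_normK ?num_real.
    rewrite /D; nra.
  by lra.
have -> : pi * cos 1 / 8 * (s ^+ 2 * y ^+ 2 / D ^+ 2) =
    pi / D * (1 / 2) * (`|s| * (cos 1 * phi)).
  rewrite /phi; have -> : s ^+ 2 = `|s| ^+ 2 by rewrite real_normK ?num_real.
  move: pi (cos 1) `|s| => p c a; field; by rewrite gt_eqF.
have pD : 0 <= pi / D by rewrite divr_ge0 ?ltW.
apply: ler_pM.
- by rewrite mulr_ge0.
- by rewrite mulr_ge0// mulr_ge0// ltW.
- by rewrite ler_wpM2l.
- by rewrite -[leLHS]add0r lerD ?mulr_ge0// ler_wpM2l.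
Qed.

(** Dividing by 10 removes the factor 100 of [walk_sqr_le], as the hypothesis of [Re_gram_ge]
    demands. *)
Definition bwalk (n : nat) : R := (walk n)%:~R / 10.

Definition energy (j k : nat) : R :=
  complex.Re (gram (j%:R - k%:R) (bwalk j - bwalk k)).

Lemma bwalk_sqr_le j k : (bwalk j - bwalk k) ^+ 2 <= `|j%:R - k%:R|.
Proof.
wlog jk : j k / (k <= j)%N.
  move=> H; have [|/ltnW] := leqP k j; first exact: H.
  by move=> /H; rewrite -sqrrN opprB distrC.
rewrite -natrB// normr_nat /bwalk -mulrBl -intrB exprMn.
rewrite exprVn ler_pdivrMr ?exprn_gt0// -rmorphXn/= mulrC -(natrX _ 10 2).
have := walk_sqr_le jk; rewrite -(ler_int R) => /le_trans; apply.
rewrite intrM.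
by have -> : (10 ^ 2 = 100)%N by [].
Qed.

Lemma energy_ge j k : pi * cos 1 / 8 *
  ((j%:R - k%:R) ^+ 2 * (bwalk j - bwalk k) ^+ 2 / (4 + (j%:R - k%:R) ^+ 2) ^+ 2)
  <= energy j k.
Proof. exact/Re_gram_ge/bwalk_sqr_le. Qed.

Lemma energy_ge0 j k : 0 <= energy j k.
Proof.
apply: le_trans (energy_ge j k).
have c0 := @cos1_gt0 R; have pi0 := @pi_gt0 R.
apply: mulr_ge0; first by rewrite divr_ge0// mulr_ge0// ltW.
by apply: divr_ge0; [apply: mulr_ge0|]; exact: sqr_ge0.
Qed.

Lemma bwalk_shift m q i : (i < 4 ^ m)%N ->
  bwalk (4 ^ m * q + i) = 2 ^+ m * bwalk q + (walk_sign q)%:~R * bwalk i.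
Proof.
move=> im; rewrite /bwalk (walk_self_similar q im).2 rmorphD !rmorphM rmorphXn/=.
by field.
Qed.

(** Within a block of length 4^m the walk is a translate of its beginning up to a global sign, and
    [gram] depends on the increment through its square. *)
Lemma energy_shift m q i k : (i < 4 ^ m)%N -> (k < 4 ^ m)%N ->
  energy (4 ^ m * q + i) (4 ^ m * q + k) = energy i k.
Proof.
move=> im km; rewrite /energy !bwalk_shift// !natrD.
have -> : (4 ^ m * q)%:R + i%:R - ((4 ^ m * q)%:R + k%:R) = i%:R - k%:R :> R by ring.
have -> : 2 ^+ m * bwalk q + (walk_sign q)%:~R * bwalk i -
    (2 ^+ m * bwalk q + (walk_sign q)%:~R * bwalk k) =
    (walk_sign q)%:~R * (bwalk i - bwalk k) by ring.
rewrite /gram -!rmorphXn exprMn.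
have -> : (walk_sign q)%:~R ^+ 2 = 1 :> R.
  by have [->|->] := walk_sign_pm1 q; rewrite -rmorphXn.
by rewrite mul1r.
Qed.

Lemma sum_blocks (F : nat -> R) k n :
  \sum_(j < k * n) F j = \sum_(q < k) \sum_(i < n) F (n * q + i)%N.
Proof.
elim: k => [|k IH]; first by rewrite mul0n !big_ord0.
rewrite mulSnr big_split_ord/= IH big_ord_recr/=; congr (_ + _).
by apply: eq_bigr => i _; rewrite mulnC.
Qed.

(* The increments b_i - b_k cancel by antisymmetry when the square of
   2^m + b_k - b_i is expanded. *)
Lemma cross_energy m :
  pi * cos 1 / 8 / 100 / 100 * 4 ^+ m <=
  \sum_(i < 4 ^ m) \sum_(k < 4 ^ m) energy (4 ^ m * 1 + i) (4 ^ m * 0 + k).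
Proof.
pose L : R := 4 ^+ m; have L0 : 0 < L by rewrite exprn_gt0.
have L1 : 1 <= L by rewrite exprn_ege1// ler1n.
have c0 := @cos1_gt0 R; have pi0 := @pi_gt0 R.
have K0 : 0 <= pi * cos 1 / 8 :> R by rewrite divr_ge0// mulr_ge0// ltW.
have E2 : (2 ^+ m) ^+ 2 = L :> R by rewrite -exprM mulnC exprM -natrX.
have LN : (4 ^ m)%:R = L :> R by rewrite natrX.
pose p : R := 2 ^+ m.
(* The square of b_i - b_k is discarded, which leaves a lower bound whose dependence on i and k is
   linear in b_i - b_k. *)
have P0 (i k : 'I_(4 ^ m)) :
    pi * cos 1 / 8 / (100 * L ^+ 2) * ((p / 10) ^+ 2 + 2 * (p / 10) * (bwalk i - bwalk k)) <=
    energy (4 ^ m * 1 + i) (4 ^ m * 0 + k).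
  apply: le_trans (energy_ge _ _).
  rewrite !bwalk_shift//.
  have -> : bwalk 1 = 10^-1 by rewrite /bwalk /walk big_ord1 mul1r.
  have -> : bwalk 0 = 0 by rewrite /bwalk walk0 mul0r.
  have -> : (walk_sign 1)%:~R = 1 :> R by [].
  rewrite muln1 muln0 add0n natrD LN !mul1r mulr0 add0r.
  have ki : (k : nat)%:R + 1 <= L by rewrite -LN natr1 ler_nat.
  have ik : (i : nat)%:R + 1 <= L by rewrite -LN natr1 ler_nat.
  have k0 : 0 <= (k : nat)%:R :> R by [].
  have i0 : 0 <= (i : nat)%:R :> R by [].
  set s := L + i%:R - k%:R.
  have s1 : 1 <= s by rewrite /s; lra.
  have s2 : s <= 2 * L by rewrite /s; lra.
  clearbody s.
  set y := 2 ^+ m * 10^-1 + bwalk i - bwalk k.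
  have yE : y ^+ 2 = (p / 10) ^+ 2 + 2 * (p / 10) * (bwalk i - bwalk k) +
      (bwalk i - bwalk k) ^+ 2 by rewrite /y /p; ring.
  have -> : pi * cos 1 / 8 / (100 * L ^+ 2) *
      ((p / 10) ^+ 2 + 2 * (p / 10) * (bwalk i - bwalk k)) = pi * cos 1 / 8 *
      (((p / 10) ^+ 2 + 2 * (p / 10) * (bwalk i - bwalk k)) / (100 * L ^+ 2)).
    by rewrite -[LHS]mulrA; congr (_ * _); exact: mulrC.
  rewrite ler_wpM2l//.
  have s20 : 0 < s ^+ 2 by rewrite exprn_gt0// (lt_le_trans ltr01).
  apply: (@le_trans _ _ (y ^+ 2 / (100 * L ^+ 2))).
    by rewrite ler_wpM2r ?invr_ge0 ?mulr_ge0 ?exprn_ge0 ?(ltW L0)// yE lerDl sqr_ge0.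
  rewrite (mulrC (s ^+ 2)) -[leRHS]mulrA ler_wpM2l ?sqr_ge0//.
  rewrite ler_pdivlMr; last by rewrite exprn_gt0// ltr_pwDl// ltW.
  rewrite mulrC ler_pdivrMr; last by rewrite mulr_gt0// exprn_gt0.
  (* Since 1 <= s <= 2 L, one has (4 + s^2)^2 <= 25 s^4 <= 100 L^2 s^2. *)
  apply: (@le_trans _ _ ((5 * s ^+ 2) ^+ 2)).
    have h : 1 <= s ^+ 2 by rewrite exprn_ege1.
    by apply: lerXn2r; rewrite ?nnegrE; lra.
  have -> : (5 * s ^+ 2) ^+ 2 = s ^+ 2 * (25 * s ^+ 2) by ring.
  rewrite ler_wpM2l ?(ltW s20)//.
  have : s ^+ 2 <= (2 * L) ^+ 2.
    by rewrite lerXn2r ?nnegrE ?mulr_ge0 ?(ltW L0)// (le_trans ler01).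
  by rewrite exprMn; lra.
apply: le_trans (ler_sum _ (fun i _ => ler_sum _ (fun k _ => P0 i k))).
under eq_bigr => i _.
  rewrite -mulr_sumr big_split/= sumr_const card_ord -mulr_sumr sumrB sumr_const card_ord.
  over.
rewrite -mulr_sumr big_split/= sumr_const card_ord -mulr_sumr sumrB sumr_const card_ord.
rewrite -sumrMnl subrr mulr0 addr0 -mulrnA -[(p / 10) ^+ 2 *+ _]mulr_natr natrM LN exprMn E2.
rewrite le_eqVlt; apply/orP; left; apply/eqP.
rewrite -/L; clear -L0; clearbody L.
by move: pi (cos 1) => q c; field; rewrite gt_eqF.
Qed.

Definition total_energy m : R :=
  \sum_(j < 4 ^ m) \sum_(k < 4 ^ m) energy j k.

(** The square of side 4^(m+1) splits into 16 blocks. The four diagonal ones are copies of the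
    smaller square, block (1, 0) contributes [cross_energy], and the others are nonnegative. *)
Lemma total_energyS m :
  4 * total_energy m + pi * cos 1 / 8 / 100 / 100 * 4 ^+ m <= total_energy m.+1.
Proof.
pose B q r := \sum_(i < 4 ^ m) \sum_(k < 4 ^ m) energy (4 ^ m * q + i) (4 ^ m * r + k).
have B0 q r : 0 <= B q r.
  by apply: sumr_ge0 => i _; apply: sumr_ge0 => k _; exact: energy_ge0.
have BE q : B q q = total_energy m.
  by apply: eq_bigr => i _; apply: eq_bigr => k _; rewrite energy_shift.
have -> : total_energy m.+1 = \sum_(q < 4) \sum_(r < 4) B q r.
  rewrite /total_energy expnS (sum_blocks (fun j => \sum_(k < 4 * 4 ^ m) energy j k)).
  apply: eq_bigr => q _; rewrite [RHS]exchange_big/=; apply: eq_bigr => i _.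
  exact: (sum_blocks (energy (4 ^ m * q + i))).
rewrite !big_ord_recr !big_ord0 /= ?add0r.
have c := cross_energy m; rewrite -/(B 1%N 0%N) in c.
rewrite !BE.
have b := B0; have := b 0%N 1%N; have := b 0%N 2%N; have := b 0%N 3%N.
have := b 1%N 2%N; have := b 1%N 3%N; have := b 2%N 0%N; have := b 2%N 1%N.
have := b 2%N 3%N; have := b 3%N 0%N; have := b 3%N 1%N; have := b 3%N 2%N.
lra.
Qed.

(** Divided by 4^(m+1), the recursion says that each scale raises total_energy m / 4^m by the same
    constant. *)
Lemma total_energy_ge m : pi * cos 1 / 8 / 100 / 100 / 4 * m%:R * 4 ^+ m <= total_energy m.
Proof.
elim: m => [|m IH].
  rewrite mulr0 mul0r; apply: sumr_ge0 => j _; apply: sumr_ge0 => k _.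
  exact: energy_ge0.
apply: le_trans (total_energyS m).
have -> : pi * cos 1 / 8 / 100 / 100 / 4 * m.+1%:R * 4 ^+ m.+1 =
    4 * (pi * cos 1 / 8 / 100 / 100 / 4 * m%:R * 4 ^+ m) +
    pi * cos 1 / 8 / 100 / 100 * 4 ^+ m :> R.
  by rewrite -natr1 exprS; move: pi (cos 1) (4 ^+ m) => p c x; field.
by rewrite lerD2r ler_wpM2l.
Qed.

End energy.

(** * The time integral and the contradiction *)

Section lower_integral.
Context {R : realType}.
Notation mu := (@lebesgue_measure R).

(* No measurability is needed: the integral of a nonnegative function is a
   supremum over the simple functions below it. *)
Lemma ge0_le_integralT d (T : measurableType d) (nu : {measure set T -> \bar R})
    (f g : T -> \bar R) :
  (forall x, 0 <= f x)%E -> (forall x, f x <= g x)%E ->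
  (\int[nu]_x f x <= \int[nu]_x g x)%E.
Proof.
move=> f0 fg; have g0 x : (0 <= g x)%E by exact: le_trans (fg x).
rewrite !ge0_integralTE//; apply: le_ereal_sup => _ [h hf <-].
by exists h => // x; exact: le_trans (hf x) (fg x).
Qed.

(** The step function with value a l on [l, l + 1[ lies below [u]; half-open intervals are disjoint,
    so at most one term is active. [u] may be nonmeasurable, hence the comparison by
    [ge0_le_integralT]. *)
Lemma sum_le_integral N (a : nat -> R) (u : R -> \bar R) :
  (forall l, 0 <= a l) -> (forall t, 0 <= u t)%E ->
  (forall l t, (l < N)%N -> l%:R <= t < l%:R + 1 -> ((a l)%:E <= u t)%E) ->
  ((\sum_(l < N) a l)%:E <= \int[mu]_t u t)%E.
Proof.
move=> a0 u0 au.
pose I (l : nat) : set R := `[l%:R, l%:R + 1[%classic.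
have mI l : measurable (I l) by exact: measurable_itv.
have IE l t : I l t = (l%:R <= t < l%:R + 1) by rewrite /I /= in_itv.
have -> : ((\sum_(l < N) a l)%:E =
    \int[mu]_t \sum_(l < N) (a l * \1_(I l) t)%:E)%E.
  rewrite ge0_integral_sum//; last 2 first.
  - move=> l; apply/measurable_EFinP.
    by apply: measurable_funM; [exact: measurable_cst|apply: measurable_indic; exact: mI].
  - by move=> l t _; rewrite lee_fin mulr_ge0.
  rewrite -sumEFin; apply: eq_bigr => l _.
  under eq_integral do rewrite EFinM.
  rewrite ge0_integralZl//; last 2 first.
  - by apply/measurable_EFinP; apply: measurable_indic; exact: mI.
  - by rewrite lee_fin.
  rewrite (integral_indic mu measurableT (mI l)) setIT /I /=
    lebesgue_measure_itv/= lte_fin ltrDl ltr01.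
  by rewrite -EFinB addrAC subrr add0r mule1.
apply: ge0_le_integralT => t.
  by apply: sume_ge0 => l _; rewrite lee_fin mulr_ge0.
have [[l lt]|nl] := pselect (exists l : 'I_N, I l t).
  rewrite (bigD1 l)//= big1 ?adde0.
    by rewrite indicE mem_set// mulr1; apply: au; rewrite -?IE.
  move=> k kl; rewrite indicE memNset ?mulr0//= => kt.
  move: kl; rewrite -val_eqE /=; apply/negP; rewrite negbK.
  move: lt kt; rewrite !IE => /andP[l1 l2] /andP[k1 k2].
  have h1 : (k < l.+1)%N by rewrite -(ltr_nat R) -natr1 (le_lt_trans k1).
  have h2 : (l < k.+1)%N by rewrite -(ltr_nat R) -natr1 (le_lt_trans l1).
  by apply/eqP; lia.
rewrite big1// => l _; rewrite indicE memNset ?mulr0// => lt.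
by apply: nl; exists l.
Qed.

End lower_integral.

(** For S = [total_energy m] and K = 16 pi^2 c^2, the assumed inequality gives that the sum of
    |T_l|^2 is at most K S, with K = (8 pi^2)^2 c^2 / (4 pi^2), while S is at most the sum of |T_l|
    over N = 4^m indices. *)
Lemma packet_energy_bound (R : realType) (c : R) :
  (forall f : R * R -> R[i], in_Lp 2%:E f ->
    (sq_time_integral (fun t : R => schrodinger t f) `^ 2^-1
       <= c%:E * LpnormC 2%:E f)%E) ->
  forall m, total_energy m <= (16 * pi * pi * c ^+ 2 + 1) * 4 ^+ m :> R.
Proof.
move=> Hc m; set N := (4 ^ m)%N; pose f := packet_sum N (@bwalk R).
have pi0 := @pi_gt0 R.
pose T l := row_sum N (@bwalk R) l.
have f2 : in_Lp 2%:E f by exact: in_Lp2_packet_sum.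
have Hf := Hc f f2.
have SE : total_energy m = \sum_(l < N) complex.Re (T l).
  rewrite /total_energy exchange_big; apply: eq_bigr => l _.
  by rewrite Re_sum.
have fnorm : LpnormC 2%:E f = (Num.sqrt ((4 * pi * pi)^-1 * total_energy m))%:E.
  have [_ /integrable_modulus i2] := (in_Lp2P f).1 f2.
  have fin : (\int[@leb2_sfinite R]_x (modulus (f x) ^+ 2)%:E)%E \is a fin_num.
    under eq_integral => x _.
      have -> : modulus (f x) ^+ 2 = modulus (f x * (f x)^*%C).
        by rewrite modulusM modulus_conj expr2.
      over.
    exact: integrable_fin_num.
  rewrite LpnormC2E -[X in (X `^ _)%E](fineK fin).
  have := packet_sum_norm N (@bwalk R); rewrite /Rintegral => ->; rewrite -SE.
  rewrite poweR_EFin powR12_sqrt//.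
  rewrite mulr_ge0 ?invr_ge0 ?mulr_ge0 ?(ltW pi0)//.
  by apply: sumr_ge0 => j _; apply: sumr_ge0 => k _; exact: energy_ge0.
have S0 : 0 <= total_energy m :> R.
  by apply: sumr_ge0 => j _; apply: sumr_ge0 => k _; exact: energy_ge0.
pose a l := (modulus (T l) / (8 * pi * pi)) ^+ 2.
have K0 : 0 < 8 * pi * pi :> R by rewrite !mulr_gt0.
have lowb : ((\sum_(l < N) a l)%:E <= sq_time_integral (fun t : R => schrodinger t f))%E.
  apply: sum_le_integral => [l|t|l t lN /andP[lt tl]].
  - exact: sqr_ge0.
  - exact: sqre_ge0.
  (* A solution exists by explicit formula, so the chosen value is some solution; the pairing bound
     holds for every representative. *)
  - have sg : is_schrodinger t f (schrodinger t f).
      apply: xgetPex; eexists; apply: is_schrodinger_packets => j /=.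
      exact: ltr01.
    have th : 0 <= t - l%:R <= 1 by apply/andP; split; lra.
    have := @packet_sum_Linfty R N (@bwalk R) l (t - l%:R) (schrodinger t f) th.
    rewrite addrC subrK => /(_ sg).
    rewrite muleC -lee_pdivrMr// -EFinM => h.
    rewrite /a EFin_expe lee_sqr// ?LpnormC_ge0//.
    by rewrite lee_fin divr_ge0 ?modulus_ge0 ?(ltW K0).
have A0 : 0 <= \sum_(l < N) a l by apply: sumr_ge0 => l _; exact: sqr_ge0.
have H1 : (Num.sqrt (\sum_(l < N) a l) <= c * Num.sqrt ((4 * pi * pi)^-1 * total_energy m)).
  rewrite -lee_fin EFinM -fnorm; apply: le_trans Hf.
  rewrite -powR12_sqrt// -poweR_EFin; apply: gt0_ler_poweR => //.
  - by rewrite in_itv/= leey andbT lee_fin.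
  - rewrite in_itv/= leey andbT; apply: integral_ge0 => t _; exact: sqre_ge0.
(* The sign of c is unknown; squaring is legitimate because [H1] bounds its right-hand side below by
   a square root. *)
have H2 : \sum_(l < N) a l <= c ^+ 2 * ((4 * pi * pi)^-1 * total_energy m).
  have p0 : 0 <= (4 * pi * pi)^-1 * total_energy m :> R.
    by rewrite mulr_ge0// invr_ge0 !mulr_ge0// ltW.
  rewrite -[leLHS]sqr_sqrtr// -[X in _ <= _ * X]sqr_sqrtr// -exprMn.
  by rewrite lerXn2r ?nnegrE// ?sqrtr_ge0// (le_trans _ H1)// sqrtr_ge0.
have H3 : \sum_(l < N) modulus (T l) ^+ 2 <= 16 * pi * pi * c ^+ 2 * total_energy m.
  have -> : \sum_(l < N) modulus (T l) ^+ 2 = (8 * pi * pi) ^+ 2 * \sum_(l < N) a l.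
    rewrite mulr_sumr; apply: eq_bigr => l _; rewrite /a.
    by move: K0; move: (8 * pi * pi) => K K0; field; rewrite gt_eqF.
  apply: (le_trans (ler_wpM2l (sqr_ge0 _) H2)).
  rewrite le_eqVlt; apply/orP; left; apply/eqP.
  by move: pi0; move: pi => p p0; field; rewrite gt_eqF.
set K := 16 * pi * pi * c ^+ 2 in H3 *.
have Kge0 : 0 <= K.
  by rewrite mulr_ge0 ?sqr_ge0// !mulr_ge0// ltW.
(* Cauchy-Schwarz in the form |T| <= |T|^2 / (2 (K + 1)) + (K + 1) / 2. The weight K + 1 is positive
   even for c = 0, and makes the quadratic part at most S / 2, which is absorbed on the left. *)
have H4 : total_energy m <=
    (2 * (K + 1))^-1 * (K * total_energy m) + (K + 1) / 2 * 4 ^+ m :> R.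
  apply: (@le_trans _ _ (\sum_(l < N) ((2 * (K + 1))^-1 * modulus (T l) ^+ 2 + (K + 1) / 2))).
    rewrite SE; apply: ler_sum => l _.
    apply: (le_trans (le_trans (ler_norm _) (Re_le_modulus _))).
    have K1 : 0 < K + 1 by lra.
    rewrite -subr_ge0.
    have -> : (2 * (K + 1))^-1 * modulus (T l) ^+ 2 + (K + 1) / 2 - modulus (T l) =
        (2 * (K + 1))^-1 * (modulus (T l) - (K + 1)) ^+ 2.
      by field; rewrite gt_eqF.
    by rewrite mulr_ge0 ?sqr_ge0// invr_ge0 mulr_ge0// ltW.
  rewrite big_split/= -mulr_sumr sumr_const card_ord -[X in _ + X]mulr_natr natrX.
  by rewrite lerD2r ler_wpM2l// invr_ge0 mulr_ge0// addr_ge0.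
have H5 : (2 * (K + 1))^-1 * (K * total_energy m) <= total_energy m / 2.
  rewrite ler_pdivrMl; last by lra.
  have -> : 2 * (K + 1) * (total_energy m / 2) = K * total_energy m + total_energy m.
    by field.
  by rewrite lerDl.
lra.
Qed.

(** Divided by 4^m, the two bounds on [total_energy m] leave k m <= K for every m with k > 0,
    against the Archimedean property. *)
Theorem theorem1 (R : realType) :
  ~ ((forall f : R * R -> R[i], in_Lp 2%:E f ->
        in_L2_Linfty (fun t : R => schrodinger t f)) /\
     (exists c : R, forall f : R * R -> R[i], in_Lp 2%:E f ->
        (sq_time_integral (fun t : R => schrodinger t f) `^ 2^-1
           <= c%:E * LpnormC 2%:E f)%E)).
Proof.
move=> [_ [c /packet_energy_bound H]].
set K := 16 * pi * pi * c ^+ 2 + 1 in H.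
pose k : R := pi * cos 1 / 8 / 100 / 100 / 4.
have k0 : 0 < k.
  have pi0 := @pi_gt0 R; have c0 := @cos1_gt0 R.
  by rewrite !divr_gt0// mulr_gt0.
have HK m : k * m%:R <= K.
  rewrite -(@ler_pM2r _ (4 ^+ m)) ?exprn_gt0//.
  exact: le_trans (total_energy_ge m) (H m).
have := HK (Num.bound (K / k)).
apply/negP; rewrite -ltNge mulrC -ltr_pdivrMr//.
apply: archi_boundP; rewrite divr_ge0 ?(ltW k0)//.
by have := HK 0%N; rewrite mulr0.
Qed.
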